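(* Let $\nu$ be a probability measure on the discrete cube $\mathcal{C}_n=\{-1,1\}^n$. Then for every $\varepsilon \in (0,1/16)$ there exists a probability measure $\tilde\nu$ on $\mathcal{C}_n$ such that, defining $f,\tilde f$ by $\frac{d\nu}{d\mu}=e^{f}$ and $\frac{d\tilde\nu}{d\mu}=e^{\tilde f}$, one has $$|f(y)-\tilde f(y)|\le \varepsilon n\qquad \forall y\in\mathcal{C}_n,$$ and, for the unique product measure $\xi$ on $\mathcal{C}_n$ satisfying $\int y\,d\xi(y)=\int y\,d\tilde\nu(y)$, $$\mathrm{W}_1(\tilde\nu,\xi)\le 2^7\sqrt{\frac{n\,\mathcal{D}(\nu)}{\varepsilon}}+4n e^{-\frac{1}{64\varepsilon^2}}.$$ Furthermore, there exists a set $I\subseteq[n]$ with $|I|\ge n-2ne^{-\frac{1}{32\varepsilon^2}}$ such that, letting $\xi':=\pi_I(\xi)\times\pi_{[n]\setminus I}(\tilde\nu)$, one has $$\mathrm{W}_1(\tilde\nu,\xi')\le 2^6\sqrt{\frac{n\,\mathcal{D}(\nu)}{\varepsilon}}.$$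
   Context: $\mu$ denotes the uniform probability measure on $\mathcal{C}_n=\{-1,1\}^n$. For $g:\mathcal{C}_n\to\mathbb{R}$, $y\in\mathcal{C}_n$ and $i\in[n]$, the discrete derivative is $\partial_i g(y)=\frac12\big(g(y_1,\dots,y_{i-1},1,y_{i+1},\dots,y_n)-g(y_1,\dots,y_{i-1},-1,y_{i+1},\dots,y_n)\big)$ and the discrete gradient is $\nabla g(y)=(\partial_1 g(y),\dots,\partial_n g(y))$. The Gaussian width of $K\subset\mathbb{R}^n$ is $\mathbf{GW}(K)=\mathbb{E}\sup_{x\in K}\langle x,\Gamma\rangle$ with $\Gamma\sim N(0,\mathrm{Id}_n)$. The gradient complexity of $g$ is $\mathcal{D}(g)=\mathbf{GW}(\{\nabla g(y):y\in\mathcal{C}_n\}\cup\{0\})$, and for a measure $\nu$ on $\mathcal{C}_n$, $\mathcal{D}(\nu):=\mathcal{D}(\log\frac{d\nu}{d\mu})$. $\mathrm{W}_1(\nu_1,\nu_2)=\inf\mathbb{E}\, d_H(X,Y)$ over couplings $X\sim\nu_1,Y\sim\nu_2$, with $d_H$ the Hamming distance. A product measure on $\mathcal{C}_n$ is the law of a vector with independent coordinates. For a measure $\rho$ on $\mathcal{C}_n$ and $J\subseteq[n]$, $\pi_J(\rho)$ denotes the marginal law of $\rho$ on the coordinates in $J$. *)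

(* Defs.v *)
From HB Require Import structures.
From mathcomp Require Import all_boot all_order all_algebra.
From mathcomp Require Import all_classical all_reals all_analysis.
Set Implicit Arguments. Unset Strict Implicit. Unset Printing Implicit Defensive.
Import Order.TTheory GRing.Theory Num.Theory.
Local Open Scope classical_set_scope.
Local Open Scope ring_scope.

Section Cube.
Variables (R : realType) (n : nat).

(* The discrete cube C_n = {-1,1}^n: a point y is encoded by y : 'I_n -> bool,
   coordinate y_i = sgnb (y i) with true |-> 1, false |-> -1. *)
Definition cube := {ffun 'I_n -> bool}.
Definition sgnb (b : bool) : R := if b then 1 else -1.

Definition is_prob (nu : cube -> R) : Prop :=
  (forall y, 0 <= nu y) /\ \sum_(y : cube) nu y = 1.

Definition mu_unif (y : cube) : R := (2 ^+ n)^-1.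

(* log-density f = log (d nu / d mu) (meaningful when nu has full support) *)
Definition logdens (nu : cube -> R) (y : cube) : R := ln (nu y / mu_unif y).

Definition setc (y : cube) (i : 'I_n) (b : bool) : cube :=
  [ffun j => if j == i then b else y j].

Definition dpart (g : cube -> R) (i : 'I_n) (y : cube) : R :=
  (g (setc y i true) - g (setc y i false)) / 2.
Definition dgrad (g : cube -> R) (y : cube) : 'I_n -> R := fun i => dpart g i y.

Definition gdens (t : R) : R := expR (- (t ^+ 2) / 2) / Num.sqrt (2 * pi).

(* iterated integral of F against the standard Gaussian on R^k;
   the k Gaussian coordinates are collected in a list *)
Fixpoint gint (k : nat) (F : seq R -> \bar R) : \bar R :=
  match k with
  | 0 => F [::]
  | k'.+1 => (\int[@lebesgue_measure R]_t
               ((gdens t)%:E * gint k' (fun s => F (t :: s))))%E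
  end.

(* Gaussian width of a finite nonempty set K of vectors in R^n:
   E sup_{x in K} <x, Gamma>, Gamma ~ N(0, Id_n) *)
Definition gwidth (K : seq ('I_n -> R)) : \bar R :=
  gint n (fun s => \big[Order.max/-oo%E]_(x <- K)
                     (\sum_(i < n) x i * nth 0 s i)%:E).

Definition gcompl (g : cube -> R) : \bar R :=
  gwidth ((fun _ => 0) :: [seq dgrad g y | y <- enum [set: cube]]).

Definition gcompl_meas (nu : cube -> R) : \bar R := gcompl (logdens nu).

Definition dH (x y : cube) : R := #|[set i | x i != y i]|%:R.

Definition is_coupling (nu1 nu2 : cube -> R) (p : cube -> cube -> R) : Prop :=
  (forall x y, 0 <= p x y) /\
  (forall x, \sum_(y : cube) p x y = nu1 x) /\
  (forall y, \sum_(x : cube) p x y = nu2 y).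

Definition W1 (nu1 nu2 : cube -> R) : R :=
  inf [set c : R | exists p, is_coupling nu1 nu2 p /\
                     c = \sum_(x : cube) \sum_(y : cube) p x y * dH x y].

Definition meanv (rho : cube -> R) (i : 'I_n) : R :=
  \sum_(y : cube) rho y * sgnb (y i).

(* marginal law pi_J(rho), evaluated at the restriction of y to J *)
Definition margJ (rho : cube -> R) (J : {set 'I_n}) (y : cube) : R :=
  \sum_(z : cube | [forall j in J, z j == y j]) rho z.

Definition is_product (rho : cube -> R) : Prop :=
  forall y : cube, rho y = \prod_(i < n) margJ rho [set i] y.

End Cube.

(* Main.v *)
Require Import Defs.
From HB Require Import structures.
From mathcomp Require Import all_boot all_order all_algebra.
From mathcomp Require Import all_classical all_reals all_analysis.
From mathcomp Require Import measurable_realfun ring lra.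
Set Implicit Arguments. Unset Strict Implicit. Unset Printing Implicit Defensive.
Import Order.TTheory GRing.Theory Num.Theory.
Import numFieldNormedType.Exports.
Local Open Scope ring_scope.

(** Tilt nu by a random linear field: nu_th(y) ~ nu(y) e^{<th, y>} with
th = delta Gamma, Gamma a standard Gaussian vector. Averaging the supremum in the
Gaussian width over y ~ nu_th and integrating by parts gives, with g_i = d_i f,
  D(nu) >= E sum_i Gamma_i E_{nu_th}[g_i] = delta E sum_i Cov_{nu_th}(g_i, y_i).
Under nu_th the mean h_i of y_i given the other coordinates is tanh(g_i + th_i),
so Cov(g_i, y_i) = Cov(g_i, h_i), which dominates a multiple of Var(h_i) because
tanh is increasing and Lipschitz. Hence for some realization with |th|_1 of order
eps n, sum_i Var(h_i) is at most a multiple of D(nu)/eps. Resampling the coordinates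
one after the other from their marginal laws turns nu_th into xi at transport cost
(1/2) sum_i E|h_i - E h_i|, and Cauchy-Schwarz concludes. No exceptional coordinates
arise, so I = [n] works. *)

(** * Gaussian integration by parts on the line *)

(** The law over which the supremum is averaged depends on Gamma, and this is the point: for a fixed
    law of y the linear form <g(y), Gamma> has mean zero, and the lower bound would be trivial.
    Tilting along Gamma correlates y with Gamma, and the correlation surfaces as a covariance.
    Throughout, g_i is the derivative of the untilted f, the function whose gradient complexity is
    given. For a fixed realization the tilt only adds the constant th_i inside tanh, and this
    constant cancels in the differences that make up a covariance, so every tilt is controlled by
    the same g_i. The smallness of |th|_1 and of the variances must hold at the same realization.
    One functional, the sum of both quantities weighted so that their means are comparable, delivers
    both at once. The weight of |th|_1 is D(nu), so the argument divides by D(nu), and the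
    degenerate case has to be settled separately: there the g_i are constant, and no tilt is
    made. *)

Section GaussianIntegral.
Local Open Scope classical_set_scope.
Context {R : realType}.
Implicit Types (f g : R -> R) (a c t : R).
Notation mu := (@lebesgue_measure R).

Lemma gdensE : @gdens R = normal_pdf 0 1.
Proof.
apply/funext => t; rewrite normal_pdfE ?oner_neq0// /normal_peak.
rewrite /normal_fun /gdens subr0 expr1n mul1r mulrC; congr (_ * _).
by congr (Num.sqrt _)^-1; rewrite mulr_natl.
Qed.

Lemma gdens_gt0 t : 0 < gdens t.
Proof.
rewrite /gdens divr_gt0 ?expR_gt0// sqrtr_gt0 mulr_gt0 ?pi_gt0//.
Qed.

Lemma continuous_gdens : continuous (@gdens R).
Proof. by rewrite gdensE; apply: continuous_normal_pdf; rewrite oner_neq0. Qed.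

Lemma gdens_le_pdf2 t :
  gdens t * expR (t ^+ 2 / 4) = Num.sqrt 2 * normal_pdf 0 (Num.sqrt 2) t.
Proof.
have s2 : Num.sqrt 2 != 0 :> R by rewrite sqrtr_eq0 -ltNge.
rewrite normal_pdfE// /normal_peak /normal_fun /gdens subr0 sqr_sqrtr//.
rewrite mulrAC -expRD mulrA [RHS]mulrC; congr (expR _ * _).
  by rewrite -mulr_natr; field.
have -> : 2 * pi *+ 2 = 2 * (2 * pi) :> R by rewrite [RHS]mulr_natl.
have -> : Num.sqrt (2 * (2 * pi)) = Num.sqrt 2 * Num.sqrt (2 * pi) :> R by rewrite sqrtrM.
by rewrite invfM mulrA divff// mul1r.
Qed.

(* t^2 <= 4 exp(t^2/4) reduces Gaussian moments to the mass of a wider Gaussian. *)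
Lemma gdens_moment2_le t :
  gdens t * (1 + t ^+ 2) <= 5 * (Num.sqrt 2 * normal_pdf 0 (Num.sqrt 2) t).
Proof.
rewrite -gdens_le_pdf2 mulrCA ler_pM2l ?gdens_gt0//.
have := expR_ge1Dx (t ^+ 2 / 4); have := sqr_ge0 t; lra.
Qed.

Lemma integrable_moment2 :
  mu.-integrable setT (fun t => (gdens t * (1 + t ^+ 2))%:E).
Proof.
have h : mu.-integrable setT
   (fun t => (5 * (Num.sqrt 2 * normal_pdf 0 (Num.sqrt 2) t))%:E).
  under eq_fun do rewrite mulrA EFinM.
  by apply: integrableZl => //; exact: integrable_normal_pdf.
apply: (le_integrable _ _ _ h) => //.
  apply/measurable_EFinP; apply: measurable_funM.
    by rewrite gdensE; exact: measurable_normal_pdf.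
  by apply: measurable_funD => //; apply: measurable_funX.
move=> t _ /=; rewrite lee_fin.
have g0 : 0 <= gdens t * (1 + t ^+ 2).
  by rewrite mulr_ge0// ?addr_ge0 ?sqr_ge0// ltW// gdens_gt0.
by rewrite ger0_norm// (le_trans (gdens_moment2_le t))// ler_norm.
Qed.

Definition gE f : R := \int[mu]_t (gdens t * f t).

(** One condition yields continuity, hence measurability, and quadratic growth, hence integrability
    against [gdens]. It also admits [t * f t] for bounded Lipschitz [f], the integrand of the
    integration by parts. *)
Definition quadlip f : Prop := exists2 A, 0 <= A &
  forall t t', `|f t - f t'| <= A * (1 + `|t| + `|t'|) * `|t - t'|.

Lemma quadlip_growth f : quadlip f ->
  exists2 B, 0 <= B & forall t, `|f t| <= B * (1 + t ^+ 2).
Proof.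
move=> [A A0 hA]; exists (`|f 0| + 2 * A).
  by rewrite addr_ge0 ?mulr_ge0.
move=> t; have := hA t 0; rewrite normr0 subr0 addr0 => h.
have h1 : `|f t| <= `|f 0| + `|f t - f 0|.
  by rewrite -[X in `|X| <= _](subrK (f 0)) addrC ler_normD.
have t2 : t ^+ 2 = `|t| ^+ 2 by rewrite real_normK ?num_real.
have h2 : (1 + `|t|) * `|t| <= 2 * (1 + t ^+ 2).
  by rewrite t2; have := sqr_ge0 (`|t| - 1); nra.
have h3 : A * (1 + `|t|) * `|t| <= A * (2 * (1 + t ^+ 2)).
  by rewrite -mulrA ler_wpM2l.
have h4 : `|f 0| <= `|f 0| * (1 + t ^+ 2) by rewrite ler_peMr// lerDl sqr_ge0.
by rewrite mulrDl; lra.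
Qed.

Lemma quadlip_continuous f : quadlip f -> continuous f.
Proof.
move=> [A A0 hA] x; apply/cvgrPdist_le => e e0.
have c0 : 0 < A * (2 + 2 * `|x|) + 1 by rewrite ltr_wpDl// mulr_ge0.
apply/nbhs_ballP; exists (Num.min 1 (e / (A * (2 + 2 * `|x|) + 1))).
  by rewrite /= lt_min ltr01 divr_gt0.
move=> t; rewrite /ball /= lt_min => /andP[h1 h2].
apply: (le_trans (hA x t)).
have h3 : `|t| <= `|x| + 1.
  have := ler_normB x (x - t); rewrite opprB addrC subrK; lra.
have h4 : A * (1 + `|x| + `|t|) * `|x - t| <= (A * (2 + 2 * `|x|) + 1) * `|x - t|.
  rewrite ler_wpM2r// (le_trans (y := A * (2 + 2 * `|x|)))//; last by rewrite lerDl.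
  by rewrite ler_wpM2l//; lra.
by apply: (le_trans h4); rewrite mulrC -ler_pdivlMr// ltW.
Qed.

Lemma quadlip_integrable f : quadlip f ->
  mu.-integrable setT (EFin \o (fun t => gdens t * f t)).
Proof.
move=> qf; have [B B0 hB] := quadlip_growth qf.
have h : mu.-integrable setT (fun t => (B * (gdens t * (1 + t ^+ 2)))%:E).
  under eq_fun do rewrite EFinM.
  by apply: integrableZl => //; exact: integrable_moment2.
apply: (le_integrable _ _ _ h) => //.
  apply/measurable_EFinP; apply: continuous_measurable_fun => t.
  apply: continuousM; [exact: continuous_gdens|exact: quadlip_continuous].
move=> t _ /=; rewrite lee_fin normrM (ger0_norm (ltW (gdens_gt0 t))).
apply: le_trans (ler_norm _).
by rewrite mulrCA ler_wpM2l// ltW// gdens_gt0.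
Qed.

Lemma quadlip_cst c : quadlip (fun=> c).
Proof.
by exists 0 => // t t'; rewrite subrr normr0 !mul0r.
Qed.

Lemma quadlipD f g : quadlip f -> quadlip g -> quadlip (fun t => f t + g t).
Proof.
move=> [A A0 hA] [B B0 hB]; exists (A + B); first by rewrite addr_ge0.
move=> t t'; rewrite opprD addrACA !mulrDl (le_trans (ler_normD _ _))//.
by rewrite lerD// -?mulrDl.
Qed.

Lemma quadlipZ c f : quadlip f -> quadlip (fun t => c * f t).
Proof.
move=> [A A0 hA]; exists (`|c| * A); first by rewrite mulr_ge0.
by move=> t t'; rewrite -mulrBr normrM -!mulrA ler_wpM2l// mulrA.
Qed.

Lemma EFin_gE f : quadlip f ->
  (\int[mu]_t ((gdens t)%:E * (f t)%:E))%E = (gE f)%:E.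
Proof.
move=> /quadlip_integrable h; rewrite /gE /Rintegral fineK//.
exact: integrable_fin_num.
Qed.

Lemma gED f g : quadlip f -> quadlip g ->
  gE (fun t => f t + g t) = gE f + gE g.
Proof.
move=> qf qg; rewrite /gE -RintegralD//; try exact: quadlip_integrable.
by apply: eq_Rintegral => t _; rewrite mulrDr.
Qed.

Lemma gEZ c f : quadlip f -> gE (fun t => c * f t) = c * gE f.
Proof.
move=> qf; rewrite /gE -RintegralZl//; last exact: quadlip_integrable.
by apply: eq_Rintegral => t _; rewrite mulrCA.
Qed.

Lemma gE_le f g : quadlip f -> quadlip g -> (forall t, f t <= g t) ->
  gE f <= gE g.
Proof.
move=> qf qg fg; apply: le_Rintegral => //; try exact: quadlip_integrable.
by move=> t _; rewrite ler_wpM2l// ltW// gdens_gt0.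
Qed.

Lemma gE_cst c : gE (fun=> c) = c.
Proof.
rewrite /gE; under eq_Rintegral do rewrite mulrC.
have h : mu.-integrable setT (EFin \o @gdens R).
  by rewrite gdensE; exact: integrable_normal_pdf.
rewrite RintegralZl// /Rintegral gdensE.
by rewrite (_ : \int[mu]_t _ = 1)%E ?mulr1//= integral_normal_pdf.
Qed.

(** A zero expectation would make the positive integrand vanish almost everywhere, so the whole line
    would be a null set. *)
Lemma gE_gt0 f : quadlip f -> (forall t, 0 < f t) -> 0 < gE f.
Proof.
move=> qf f0; have i := quadlip_integrable qf.
have p t : 0 < gdens t * f t by rewrite mulr_gt0 ?gdens_gt0.
rewrite lt_neqAle; apply/andP; split; last first.
  by apply: Rintegral_ge0 => t _; exact: ltW.
apply/eqP => e0.
have z : (\int[mu]_t `|(EFin \o (fun t => gdens t * f t)%R) t|)%E = 0%E.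
  under eq_integral do rewrite /= ger0_norm ?(ltW (p _))//.
  by have := EFin_gE qf; rewrite -e0.
have mf : measurable_fun setT (EFin \o (fun t => gdens t * f t)).
  by case/integrableP: i.
have [ae _] := ae_eq_integral_abs mu measurableT mf.
have /negligibleP : mu.-negligible (@setT R).
  case: (ae z) => N [mN N0 hN]; exists N; split => // t _; apply: hN => /= h.
  by have := p t; have [->] := h I; rewrite ltxx.
move=> /(_ measurableT) h0.
by have := @lebesgue_measure_itv R `]-oo, +oo[%R; rewrite set_itvNyy h0.
Qed.

Lemma quadlip_norm : quadlip (fun t => `|t|).
Proof.
exists 1 => // t t'; rewrite mul1r (le_trans (ler_dist_dist _ _))//.
by rewrite ler_peMl// -addrA lerDl addr_ge0.
Qed.

(** The exact value is [sqrt (2 / pi)]. The crude bound comes from |t| <= 2 exp(t^2/4), whose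
    right-hand side has Gaussian mean 2 sqrt 2 <= 3. *)
Lemma gE_norm_le : gE (fun t => `|t|) <= 3.
Proof.
have s2 : Num.sqrt 2 <= 3 / 2 :> R.
  rewrite -(@ler_sqr R) ?nnegrE ?sqrtr_ge0 ?divr_ge0// sqr_sqrtr//; lra.
have i2 := integrable_normal_pdf 0 (Num.sqrt (2 : R)).
have i3 : mu.-integrable setT
    (fun t => (2 * Num.sqrt 2 * normal_pdf 0 (Num.sqrt 2) t)%:E).
  by under eq_fun do rewrite EFinM; exact: integrableZl.
apply: (@le_trans _ _ (\int[mu]_t (2 * Num.sqrt 2 * normal_pdf 0 (Num.sqrt 2) t))).
  apply: le_Rintegral => //; first exact: quadlip_integrable quadlip_norm.
  move=> t _; rewrite -mulrA -gdens_le_pdf2 mulrCA ler_pM2l ?gdens_gt0//.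
  have := expR_ge1Dx (t ^+ 2 / 4); have := sqr_ge0 (`|t| - 2).
  have : t ^+ 2 = `|t| ^+ 2 by rewrite real_normK ?num_real.
  nra.
rewrite RintegralZl// /Rintegral integral_normal_pdf mulr1; lra.
Qed.

Section IntegrationByParts.
Variables (f f' : R -> R) (B B' C : R).
Hypothesis fB : forall t, `|f t| <= B.
Hypothesis f'B : forall t, `|f' t| <= B'.
Hypothesis qf' : quadlip f'.
Hypothesis Taylor : forall t h, `|h| <= 1 ->
  `|f (t + h) - f t - h * f' t| <= C * h ^+ 2.

Lemma Taylor_is_derive t : is_derive t 1 f (f' t).
Proof.
have c : h^-1 *: ((f \o shift t) (h *: (1 : R)) - f t) @[h --> 0^'] --> f' t.
  apply/cvgrPdist_le => e e0.
  have C0 : 0 < `|C| + 1 by rewrite ltr_wpDl.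
  apply/nbhs_ballP; exists (Num.min 1 (e / (`|C| + 1))).
    by rewrite /= lt_min ltr01 divr_gt0.
  move=> h; rewrite /ball /= lt_min sub0r normrN => /andP[h1 h2] h0.
  have := Taylor t (ltW h1).
  rewrite /shift /= [h *: _]mulr1 (addrC t).
  have -> : f' t - h^-1 *: (f (h + t) - f t) =
     - (h^-1 * (f (h + t) - f t - h * f' t)).
    by rewrite [_ *: _]/GRing.scale /= [in RHS]mulrBr mulKf// opprB.
  rewrite normrN normrM normfV => T.
  rewrite ler_pdivrMl ?normr_gt0// (le_trans T)//.
  have -> : h ^+ 2 = `|h| * `|h| by rewrite -expr2 real_normK ?num_real.
  rewrite mulrCA ler_wpM2l//.
  apply: (@le_trans _ _ ((`|C| + 1) * `|h|)).
    by rewrite ler_wpM2r// (le_trans (ler_norm C))// lerDl.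
  by rewrite mulrC -ler_pdivlMr// ltW.
have d : derivable f t 1 by apply/cvg_ex; exists (f' t).
by apply: DeriveDef => //; exact/cvg_lim.
Qed.

Lemma is_derive_gdens t : is_derive t 1 (@gdens R) (- t * gdens t).
Proof.
have -> : @gdens R =
    (fun x => (Num.sqrt (2 * pi))^-1 *: expR (- (2^-1) *: x ^+ 2)).
  apply/funext => x; rewrite /gdens mulrC /GRing.scale /=.
  by congr (_ * expR _); rewrite mulNr mulrC mulNr.
apply: is_derive_eq.
rewrite /GRing.scale /=; set a := expR _; set b := _^-1; by field.
Qed.

Hypothesis qtf : quadlip (fun t => t * f t).

(** [u] is the derivative of [gdens t * f t]; integration by parts amounts to its integral over the
    line being zero. *)
Let u t := gdens t * (f' t - t * f t).

Let int_u : mu.-integrable setT (EFin \o u).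
Proof.
apply: quadlip_integrable.
have := quadlipD qf' (quadlipZ (-1) qtf).
by under eq_fun do rewrite mulN1r.
Qed.

Let int_u_itv N : 0 < N ->
  \int[mu]_(t in `[- N, N]) u t = gdens N * f N - gdens (- N) * f (- N).
Proof.
move=> N0.
have du t : is_derive t 1 (fun t => gdens t * f t) (u t).
  have h1 := is_derive_gdens t; have h2 := Taylor_is_derive t.
  apply: is_derive_eq; rewrite /GRing.scale /= /u; ring.
have cU : continuous (fun t => gdens t * f t).
  move=> t; apply: differentiable_continuous; apply/derivable1_diffP.
  by have [] := du t.
rewrite /Rintegral (@continuous_FTC2 R u (fun t => gdens t * f t))//.
- by rewrite gtrN.
- apply: continuous_subspaceT => t; apply: continuousM; first exact: continuous_gdens.
  apply: (@quadlip_continuous (fun t => f' t - t * f t)).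
  have := quadlipD qf' (quadlipZ (-1) qtf).
  by under eq_fun do rewrite mulN1r.
- split.
  + by move=> t _; have [] := du t.
  + by apply: cvg_at_right_filter; exact: cU.
  + by apply: cvg_at_left_filter; exact: cU.
- by move=> t _; rewrite derive1E; have [_ ->] := du t.
Qed.

Let K2 : R := 5 * (Num.sqrt 2 * normal_peak (Num.sqrt 2)).

Let gdens_decay N : 0 < N -> gdens N <= K2 / N.
Proof.
move=> N0; rewrite ler_pdivlMr//.
apply: (@le_trans _ _ (gdens N * (1 + N ^+ 2))).
  rewrite ler_pM2l ?gdens_gt0//; have := sqr_ge0 (N - 1); nra.
apply: (le_trans (gdens_moment2_le N)).
rewrite ler_pM2l// ler_wpM2l ?sqrtr_ge0//; apply: normal_pdf_ub.
by rewrite sqrtr_eq0 -ltNge.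
Qed.

(** No limit is taken: N times the absolute integral of [u] is bounded by a constant [K] for all N >
    0. Outside [-N, N] a factor |t|/N > 1 is traded against the second moment, and the two boundary
    terms decay like 1/N by [gdens_decay]. *)
Lemma gaussian_ibp : gE (fun t => t * f t) = gE f'.
Proof.
have B0 : 0 <= B by apply: le_trans (fB 0).
have B'0 : 0 <= B' by apply: le_trans (f'B 0).
pose M2 := \int[mu]_t (gdens t * (1 + t ^+ 2)).
pose K := (B' + B) * M2 + 2 * B * K2.
have JE : \int[mu]_t u t = gE f' - gE (fun t => t * f t).
  rewrite /gE -RintegralB//; try exact: quadlip_integrable.
  by apply: eq_Rintegral => t _; rewrite /u mulrBr.
have tail N : 0 < N -> `|\int[mu]_t u t| * N <= K.
  move=> N0.
  have iD : mu.-integrable setT (EFin \o (u \_ `[- N, N])).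
    rewrite -restrict_EFin; apply/integrable_restrict => //=.
    by rewrite setTI; apply: integrableS int_u.
  have bnd t : `|u t - (u \_ `[- N, N]) t| <=
      (B' + B) / N * (gdens t * (1 + t ^+ 2)).
    have r0 : 0 <= (B' + B) / N * (gdens t * (1 + t ^+ 2)).
      by rewrite mulr_ge0// ?divr_ge0 ?addr_ge0 ?(ltW N0)// mulr_ge0 ?addr_ge0 ?sqr_ge0// ltW ?gdens_gt0.
    rewrite patchE; case: ifPn => [_|]; first by rewrite subrr normr0.
    rewrite notin_setE /= in_itv /= => /negP; rewrite -ler_norml -ltNge => Nt.
    rewrite subr0 /u normrM (ger0_norm (ltW (gdens_gt0 t))) mulrCA.
    rewrite ler_pM2l ?gdens_gt0//.
    apply: (@le_trans _ _ (B' + `|t| * B)).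
      rewrite (le_trans (ler_normB _ _))// lerD// normrM ler_wpM2l//.
    rewrite mulrAC ler_pdivlMr//.
    have t2 : t ^+ 2 = `|t| ^+ 2 by rewrite real_normK ?num_real.
    have h1 : (B' + `|t| * B) * N <= (B' + `|t| * B) * `|t|.
      by rewrite ler_wpM2l ?addr_ge0 ?mulr_ge0// ltW.
    rewrite t2; apply: (le_trans h1).
    have := sqr_ge0 (`|t| - 1); have := normr_ge0 t; nra.
  have -> : \int[mu]_t u t = \int[mu]_t (u t - (u \_ `[- N, N]) t) +
      (gdens N * f N - gdens (- N) * f (- N)).
    by rewrite -int_u_itv// [X in _ + X]Rintegral_mkcond RintegralB// subrK.
  have b1 : `|\int[mu]_t (u t - (u \_ `[- N, N]) t)| <= (B' + B) / N * M2.
    have iB : mu.-integrable setT (EFin \o (fun t => u t - (u \_ `[- N, N]) t)).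
      exact: (integrableB measurableT int_u iD).
    apply: (le_trans (le_normr_Rintegral _ iB)) => //.
    rewrite /M2 -RintegralZl//; last exact: integrable_moment2.
    apply: le_Rintegral => //.
    - have := integrable_abse iB; by [].
    - have h : mu.-integrable setT (fun t => ((B' + B) / N * (gdens t * (1 + t ^+ 2)))%:E).
        under eq_fun do rewrite EFinM.
        by apply: integrableZl => //; exact: integrable_moment2.
      exact: h.
  have b2 t : `|t| = N -> `|gdens t * f t| <= K2 / N * B.
    move=> tN; rewrite normrM ler_pM//.
    rewrite ger0_norm ?(ltW (gdens_gt0 _))//.
    have -> : gdens t = gdens N by rewrite /gdens -(real_normK (num_real t)) tN.
    exact: gdens_decay.
  have b3 := b2 N (gtr0_norm N0).
  have b4 : `|gdens (- N) * f (- N)| <= K2 / N * B.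
    by apply: b2; rewrite normrN gtr0_norm.
  rewrite -ler_pdivlMr//.
  have -> : K / N = (B' + B) / N * M2 + (K2 / N * B + K2 / N * B).
    by rewrite /K; ring.
  apply: (le_trans (ler_normD _ _)); apply: lerD => //.
  by apply: (le_trans (ler_normB _ _)); apply: lerD.
apply/eqP; rewrite eq_sym -subr_eq0 -JE; apply/eqP/normr0_eq0/eqP.
rewrite eq_le normr_ge0 andbT leNgt; apply/negP => J0.
have K0 : 0 <= K by apply: le_trans (tail 1 ltr01); rewrite mulr_ge0.
(* With J the absolute value of the integral, taking N = 1 + K/J in [tail] gives J + K <= K. *)
have := tail (1 + K / `|\int[mu]_t u t|).
rewrite mulrDr mulr1 mulrCA divff ?gt_eqF// mulr1.
have h : 0 < 1 + K / `|\int[mu]_t u t| by rewrite ltr_pwDl// divr_ge0.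
by move=> /(_ h); lra.
Qed.

End IntegrationByParts.

End GaussianIntegral.

(** * Iterated Gaussian integrals *)

Section IteratedGaussian.
Context {R : realType}.
Implicit Types (k i : nat) (F G : seq R -> R) (s : seq R) (t c h : R).

Definition norm1 k s : R := \sum_(i < k) `|nth 0 s i|.
(** Only the first [k] entries count, lists being padded by zeros, so a bound by [dist1 k] also says
    that a function ignores the rest of the list. *)
Definition dist1 k s s' : R := \sum_(i < k) `|nth 0 s i - nth 0 s' i|.

Lemma norm1_ge0 k s : 0 <= norm1 k s.
Proof. by apply: sumr_ge0. Qed.

Lemma dist1_ge0 k s s' : 0 <= dist1 k s s'.
Proof. by apply: sumr_ge0. Qed.

Lemma norm1_cons k t s : norm1 k.+1 (t :: s) = `|t| + norm1 k s.
Proof. by rewrite /norm1 big_ord_recl. Qed.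

Lemma dist1_cons k t t' s s' :
  dist1 k.+1 (t :: s) (t' :: s') = `|t - t'| + dist1 k s s'.
Proof. by rewrite /dist1 big_ord_recl. Qed.

Lemma dist1xx k s : dist1 k s s = 0.
Proof. by rewrite /dist1 big1// => i _; rewrite subrr normr0. Qed.

(* Unlike mere measurability, this condition is inherited by partial Gaussian
   integrals, which makes the iterated integral [gint] tractable. *)
Definition qLip k F : Prop := exists2 A, 0 <= A &
  forall s s', `|F s - F s'| <= A * (1 + norm1 k s + norm1 k s') * dist1 k s s'.

Fixpoint gEn k F : R :=
  if k is k'.+1 then gE (fun t => gEn k' (fun s => F (t :: s))) else F [::].

Lemma qLip_cons k F t : qLip k.+1 F -> qLip k (fun s => F (t :: s)).
Proof.
move=> [A A0 hA]; exists (A * (1 + 2 * `|t|)).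
  by rewrite mulr_ge0// addr_ge0// mulr_ge0.
move=> s s'; apply: (le_trans (hA _ _)).
rewrite dist1_cons subrr normr0 add0r !norm1_cons ler_wpM2r ?dist1_ge0//.
rewrite -mulrA ler_wpM2l//.
have := norm1_ge0 k s; have := norm1_ge0 k s'; have := normr_ge0 t; nra.
Qed.

Lemma qLip_cst k c : qLip k (fun=> c).
Proof. by exists 0 => // s s'; rewrite subrr normr0 !mul0r. Qed.

Lemma qLipD k F G : qLip k F -> qLip k G -> qLip k (fun s => F s + G s).
Proof.
move=> [A A0 hA] [B B0 hB]; exists (A + B); first by rewrite addr_ge0.
move=> s s'; rewrite opprD addrACA !mulrDl (le_trans (ler_normD _ _))//.
by rewrite lerD// -?mulrDl.
Qed.

Lemma qLipZ k c F : qLip k F -> qLip k (fun s => c * F s).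
Proof.
move=> [A A0 hA]; exists (`|c| * A); first by rewrite mulr_ge0.
by move=> s s'; rewrite -mulrBr normrM -!mulrA ler_wpM2l// mulrA.
Qed.

Lemma qLip_sum k (I : Type) (r : seq I) (F : I -> seq R -> R) :
  (forall j, qLip k (F j)) -> qLip k (fun s => \sum_(j <- r) F j s).
Proof.
move=> nF; elim: r => [|j r IH].
  by under eq_fun do rewrite big_nil; exact: qLip_cst.
by under eq_fun do rewrite big_cons; exact: qLipD.
Qed.

Lemma qLip_Lipschitz k F L :
  (forall s s', `|F s - F s'| <= L * dist1 k s s') -> qLip k F.
Proof.
move=> hL; exists `|L| => // s s'; apply: (le_trans (hL s s')).
rewrite ler_wpM2r ?dist1_ge0// (le_trans (ler_norm L))// ler_peMr//.
by rewrite -addrA lerDl addr_ge0 ?norm1_ge0.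
Qed.

Lemma qLip_norm1 k : qLip k (norm1 k).
Proof.
apply: (@qLip_Lipschitz k _ 1) => s s'; rewrite mul1r /norm1 /dist1 -sumrB.
apply: (le_trans (ler_norm_sum _ _ _)); apply: ler_sum => i _.
exact: ler_dist_dist.
Qed.

(** One induction for all five: monotonicity and additivity at a level need the partial integral to
    be [quadlip], which at that level is derived from monotonicity and linearity in turn. *)
Lemma gEn_facts k :
  [/\ (forall F G, qLip k F -> qLip k G -> (forall s, F s <= G s) -> gEn k F <= gEn k G),
      (forall F G, qLip k F -> qLip k G -> gEn k (fun s => F s + G s) = gEn k F + gEn k G),
      (forall c F, qLip k F -> gEn k (fun s => c * F s) = c * gEn k F),
      (forall c, gEn k (fun=> c) = c) &
      (forall F, qLip k.+1 F -> quadlip (fun t => gEn k (fun s => F (t :: s))))].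
Proof.
elim: k => [|k [mono add scal cst qlip]].
  split=> //= F [A A0 hA]; exists A => // t t'; have := hA [:: t] [:: t'].
  by rewrite dist1_cons !norm1_cons /dist1 /norm1 !big_ord0 !addr0.
have mono' F G : qLip k.+1 F -> qLip k.+1 G -> (forall s, F s <= G s) ->
    gEn k.+1 F <= gEn k.+1 G.
  move=> nF nG FG; apply: gE_le; [exact: qlip|exact: qlip|] => t.
  by apply: mono => //; exact: qLip_cons.
have add' F G : qLip k.+1 F -> qLip k.+1 G ->
    gEn k.+1 (fun s => F s + G s) = gEn k.+1 F + gEn k.+1 G.
  move=> nF nG; rewrite /= -gED; [|exact: qlip|exact: qlip].
  by congr gE; apply/funext => t; apply: add; exact: qLip_cons.
have scal' c F : qLip k.+1 F -> gEn k.+1 (fun s => c * F s) = c * gEn k.+1 F.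
  move=> nF; rewrite /= -gEZ; last exact: qlip.
  by congr gE; apply/funext => t; apply: scal; exact: qLip_cons.
have cst' c : gEn k.+1 (fun=> c) = c.
  by rewrite /=; under eq_fun do rewrite cst; exact: gE_cst.
split => // F [A A0 hA].
have nF : qLip k.+2 F by exists A.
(* Averaging the local Lipschitz constant over the remaining variables turns 1 + |t| + |t'| + 2
   [norm1] into 1 + |t| + |t'| + 2m, at most (1 + 2m)(1 + |t| + |t'|). *)
pose m := gEn k.+1 (norm1 k.+1).
have m0 : 0 <= m.
  by rewrite -(cst' 0); apply: mono'; [exact: qLip_cst|exact: qLip_norm1|exact: norm1_ge0].
exists (A * (1 + 2 * m)); first by rewrite mulr_ge0// addr_ge0// mulr_ge0.
have half t t' : gEn k.+1 (fun s => F (t :: s)) - gEn k.+1 (fun s => F (t' :: s)) <=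
    A * (1 + 2 * m) * (1 + `|t| + `|t'|) * `|t - t'|.
  pose c0 := A * (1 + `|t| + `|t'|) * `|t - t'|; pose c1 := A * 2 * `|t - t'|.
  have nb : qLip k.+1 (fun s => c0 + c1 * norm1 k.+1 s).
    by apply: qLipD; [exact: qLip_cst|apply: qLipZ; exact: qLip_norm1].
  have nt u : qLip k.+1 (fun s => F (u :: s)) by exact: qLip_cons.
  have E : gEn k.+1 (fun s => F (t :: s)) <=
      gEn k.+1 (fun s => F (t' :: s) + (c0 + c1 * norm1 k.+1 s)).
    apply: mono' => //; first exact: qLipD.
    move=> s; have := hA (t :: s) (t' :: s).
    rewrite dist1_cons dist1xx addr0 !norm1_cons => h.
    have := le_trans (ler_norm _) h; rewrite /c0 /c1.
    move: (norm1 _ _) `|t| `|t'| `|t - t'| (F _) (F _) => a b c d e f; lra.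
  rewrite lerBlDl; apply: (le_trans E); rewrite add'// lerD2l add' ?scal' ?cst'//;
    try exact: qLip_norm1; try exact: qLip_cst; last by apply: qLipZ; exact: qLip_norm1.
  rewrite -/m /c0 /c1.
  have p : 0 <= A * `|t - t'| * m * (`|t| + `|t'|) by rewrite !mulr_ge0 ?addr_ge0.
  move: p; move: `|t| `|t'| `|t - t'| => b c d; lra.
move=> t t'; rewrite ler_norml; apply/andP; split; last exact: half.
by rewrite lerNl opprB (distrC t) (addrAC 1); exact: half.
Qed.

Lemma gEn_le k F G : qLip k F -> qLip k G -> (forall s, F s <= G s) ->
  gEn k F <= gEn k G.
Proof. by have [+ _ _ _ _] := gEn_facts k; exact. Qed.

Lemma gEnD k F G : qLip k F -> qLip k G ->
  gEn k (fun s => F s + G s) = gEn k F + gEn k G.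
Proof. by have [_ + _ _ _] := gEn_facts k; exact. Qed.

Lemma gEnZ k c F : qLip k F -> gEn k (fun s => c * F s) = c * gEn k F.
Proof. by have [_ _ + _ _] := gEn_facts k; exact. Qed.

Lemma gEn_cst k c : gEn k (fun=> c) = c.
Proof. by have [_ _ _ + _] := gEn_facts k; exact. Qed.

Lemma gEn_quadlip k F : qLip k.+1 F -> quadlip (fun t => gEn k (fun s => F (t :: s))).
Proof. by have [_ _ _ _ +] := gEn_facts k; exact. Qed.

Lemma gEn_sum k (I : Type) (r : seq I) (F : I -> seq R -> R) :
  (forall j, qLip k (F j)) ->
  gEn k (fun s => \sum_(j <- r) F j s) = \sum_(j <- r) gEn k (F j).
Proof.
move=> nF; elim: r => [|j r IH].
  by under eq_fun do rewrite big_nil; rewrite gEn_cst big_nil.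
under eq_fun do rewrite big_cons.
by rewrite gEnD// ?IH ?big_cons//; exact: qLip_sum.
Qed.

Lemma EFin_gEn k F : qLip k F -> gint k (fun s => (F s)%:E) = (gEn k F)%:E.
Proof.
elim: k F => [//|k IH] F nF /=.
under eq_integral => t _ do rewrite (IH _ (qLip_cons t nF)).
exact: EFin_gE (gEn_quadlip nF).
Qed.

Lemma gEn_gt0 k F : qLip k F -> (forall s, 0 < F s) -> 0 < gEn k F.
Proof.
elim: k F => [|k IH] F nF F0 //=.
apply: gE_gt0; first exact: gEn_quadlip.
by move=> t; apply: IH => //; exact: qLip_cons.
Qed.

(** First-moment method: if [F] exceeded [c] everywhere, [F - c] would have strictly positive
    expectation. *)
Lemma gEn_le_exists k F c : qLip k F -> gEn k F <= c -> exists s, F s <= c.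
Proof.
move=> nF Fc; apply: contrapT => h.
have : 0 < gEn k (fun s => F s + (- c)).
  apply: gEn_gt0; first by apply: qLipD => //; exact: qLip_cst.
  by move=> s; rewrite subr_gt0 ltNge; apply/negP => ?; apply: h; exists s.
by rewrite gEnD ?gEn_cst ?subr_gt0 ?ltNge ?Fc//; exact: qLip_cst.
Qed.

Lemma gEn_norm_le k F c : qLip k F -> (forall s, `|F s| <= c) -> `|gEn k F| <= c.
Proof.
move=> nF Fc; rewrite ler_norml; apply/andP; split.
  rewrite -(gEn_cst k (- c)); apply: gEn_le => //; first exact: qLip_cst.
  by move=> s; have := Fc s; rewrite ler_norml => /andP[].
rewrite -[leRHS](gEn_cst k); apply: gEn_le => //; first exact: qLip_cst.
by move=> s; have := Fc s; rewrite ler_norml => /andP[].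
Qed.

Lemma gEn_norm1_le k : gEn k (norm1 k) <= 3 * k%:R.
Proof.
elim: k => [|k IH]; first by rewrite /= /norm1 big_ord0 mulr0.
rewrite /=.
have -> : (fun t => gEn k (fun s => norm1 k.+1 (t :: s))) =
    (fun t => `|t| + gEn k (norm1 k)).
  apply/funext => t; under eq_fun do rewrite norm1_cons.
  by rewrite gEnD ?gEn_cst//; [exact: qLip_cst|exact: qLip_norm1].
rewrite gED ?gE_cst; [|exact: quadlip_norm|exact: quadlip_cst].
by rewrite -natr1; have := @gE_norm_le R; lra.
Qed.

Definition bump_nth i h s : seq R := set_nth 0 s i (nth 0 s i + h).

(* The derivative enters through a uniform Taylor bound, since such a bound
   integrates over the other variables and thus differentiates under the integral. *)
Lemma gEn_ibp k i F F' (B B' C : R) : (i < k)%N ->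
  qLip k F -> qLip k F' -> qLip k (fun s => nth 0 s i * F s) ->
  (forall s, `|F s| <= B) -> (forall s, `|F' s| <= B') ->
  (forall s h, `|h| <= 1 -> `|F (bump_nth i h s) - F s - h * F' s| <= C * h ^+ 2) ->
  gEn k (fun s => nth 0 s i * F s) = gEn k F'.
Proof.
elim: k i F F' => [//|k IH] [|i] F F' ik nF nF' nsF FB F'B T /=; last first.
  congr gE; apply/funext => t.
  apply: (IH i (fun s => F (t :: s)) (fun s => F' (t :: s))) => //; try exact: qLip_cons.
    exact: (qLip_cons t nsF).
  by move=> s h h1; exact: (T (t :: s) h h1).
have nt G u : qLip k.+1 G -> qLip k (fun s => G (u :: s)) by exact: qLip_cons.
pose H t := gEn k (fun s => F (t :: s)).
have HE : (fun t => gEn k (fun s => t * F (t :: s))) = (fun t => t * H t).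
  by apply/funext => t; rewrite gEnZ//; exact: nt.
rewrite HE; apply: (@gaussian_ibp R H _ B B' C).
- by move=> t; apply: gEn_norm_le => //; exact: nt.
- by move=> t; apply: gEn_norm_le => //; exact: nt.
- exact: gEn_quadlip.
- move=> t h h1.
  have -> : H (t + h) - H t - h * gEn k (fun s => F' (t :: s)) =
      gEn k (fun s => F (t + h :: s) + (-1) * F (t :: s) + (- h) * F' (t :: s)).
    rewrite !gEnD ?gEnZ ?mulN1r ?mulNr//; try exact: nt; try (by apply: qLipZ; exact: nt).
    by apply: qLipD; [exact: nt|apply: qLipZ; exact: nt].
  apply: gEn_norm_le.
    by apply: qLipD; [apply: qLipD; [exact: nt|]|]; apply: qLipZ; exact: nt.
  by move=> s; rewrite mulN1r mulNr; exact: (T (t :: s) h h1).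
- by rewrite -HE; exact: (gEn_quadlip nsF).
Qed.

End IteratedGaussian.

(** * Couplings and coordinate resampling *)

Section Transport.
Context {R : realType} {n : nat}.
Implicit Types (rho nu : cube n -> R) (x y z : cube n) (c : R).

Lemma dH_sum x y : dH R x y = \sum_(i < n) (x i != y i)%:R.
Proof.
rewrite /dH -natr_sum -sum1_card.
rewrite big_mkcond /=; congr (_%:R); apply: eq_bigr => i _.
by rewrite unfold_in /= asboolb; case: (x i != y i).

Qed.

Lemma dH_ge0 x y : 0 <= dH R x y.
Proof. by rewrite ler0n. Qed.

Lemma dHxx x : dH R x x = 0.
Proof. by rewrite dH_sum big1// => i _; rewrite eqxx. Qed.

Lemma dH_triangle x y z : dH R x z <= dH R x y + dH R y z.
Proof.
rewrite !dH_sum -big_split /=; apply: ler_sum => i _; rewrite -natrD ler_nat.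
by case: (x i); case: (y i); case: (z i).
Qed.

(** An explicit coupling, rather than the infimum [W1], witnesses the cost, so that bounds can be
    glued along a chain of measures. *)
Definition transport rho nu c : Prop := exists p, is_coupling rho nu p /\
  \sum_(x : cube n) \sum_(y : cube n) p x y * dH R x y <= c.

Lemma W1_le rho nu c : transport rho nu c -> W1 rho nu <= c.
Proof.
move=> [p [cp pc]]; apply: le_trans pc; apply: ge_inf; last by exists p.
exists 0 => _ [q [[q0 _] ->]].
by apply: sumr_ge0 => x _; apply: sumr_ge0 => y _; rewrite mulr_ge0 ?dH_ge0.
Qed.

Lemma sum_delta (F : cube n -> R) x : \sum_y (y == x)%:R * F y = F x.
Proof.
rewrite (bigD1 x)//= eqxx mul1r big1 ?addr0// => y /negbTE ->.
by rewrite mul0r.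
Qed.

Lemma transport_refl rho : (forall x, 0 <= rho x) -> transport rho rho 0.
Proof.
move=> rho0; exists (fun x y => (y == x)%:R * rho x); split; last first.
  rewrite big1// => x _; rewrite big1// => y _.
  by case: eqP => [->|_]; rewrite ?dHxx ?mulr0 ?mul0r.
split; first by move=> x y; rewrite mulr_ge0.
split; first by move=> x; rewrite (sum_delta (fun=> rho x)).
by move=> y; under eq_bigr do rewrite eq_sym; rewrite sum_delta.
Qed.

Lemma le_term_sum (F : cube n -> R) x : (forall y, 0 <= F y) -> F x <= \sum_y F y.
Proof. by move=> F0; rewrite (bigD1 x)//= lerDl sumr_ge0. Qed.

(* Where [nu y = 0] both couplings vanish at y, so the junk value
   [_ / 0 = 0] in the glued coupling is harmless. *)
Lemma transport_trans rho nu kap c1 c2 :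
  transport rho nu c1 -> transport nu kap c2 -> transport rho kap (c1 + c2).
Proof.
move=> [p [[p0 [pl pr]] pc]] [q [[q0 [ql qr]] qc]].
have pK x y : p x y * (nu y / nu y) = p x y.
  have [nz|nz] := eqVneq (nu y) 0; last by rewrite divff// mulr1.
  have : p x y <= 0 by rewrite -nz -pr; apply: (@le_term_sum (fun x => p x y)).
  by move=> h; rewrite (@le_anti _ _ (p x y) 0) ?mul0r// h p0.
have qK y z : q y z * (nu y / nu y) = q y z.
  have [nz|nz] := eqVneq (nu y) 0; last by rewrite divff// mulr1.
  have : q y z <= 0 by rewrite -nz -ql; apply: (@le_term_sum (q y)).
  by move=> h; rewrite (@le_anti _ _ (q y z) 0) ?mul0r// h q0.
have nu0 y : 0 <= nu y by rewrite -pr sumr_ge0.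
pose g x y z := p x y * q y z / nu y.
have g0 x y z : 0 <= g x y z by rewrite /g !mulr_ge0 ?invr_ge0.
have gz x y : \sum_z g x y z = p x y.
  by rewrite -mulr_suml -mulr_sumr ql -mulrA pK.
have gx y z : \sum_x g x y z = q y z.
  by rewrite -!mulr_suml pr mulrAC mulrC qK.
exists (fun x z => \sum_y g x y z); split.
  split; first by move=> x z; apply: sumr_ge0.
  split; first by move=> x; rewrite exchange_big /= -pl; apply: eq_bigr.
  by move=> z; rewrite exchange_big /= -qr; apply: eq_bigr.
apply: (@le_trans _ _ (\sum_x \sum_z \sum_y (g x y z * dH R x y + g x y z * dH R y z))).
  apply: ler_sum => x _; apply: ler_sum => z _.
  rewrite mulr_suml; apply: ler_sum => y _.
  by rewrite -mulrDr ler_wpM2l// dH_triangle.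
apply: le_trans (lerD pc qc); rewrite le_eqVlt; apply/orP; left; apply/eqP.
have -> : \sum_x \sum_y p x y * dH R x y = \sum_x \sum_z \sum_y g x y z * dH R x y.
  apply: eq_bigr => x _; rewrite exchange_big /=; apply: eq_bigr => y _.
  by rewrite -mulr_suml gz.
have -> : \sum_y \sum_z q y z * dH R y z = \sum_x \sum_z \sum_y g x y z * dH R y z.
  rewrite exchange_big /= [RHS]exchange_big /=; apply: eq_bigr => z _.
  rewrite [RHS]exchange_big /=; apply: eq_bigr => y _.
  by rewrite -mulr_suml gx.
rewrite -big_split /=; apply: eq_bigr => x _.
by rewrite -big_split /=; apply: eq_bigr => z _; rewrite -big_split.
Qed.

Lemma transport_le rho nu c c' : c <= c' -> transport rho nu c -> transport rho nu c'.
Proof. by move=> cc [p [cp pc]]; exists p; split => //; exact: le_trans pc cc. Qed.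

Definition l1norm rho : R := \sum_x `|rho x|.

(** The common mass [min(rho, nu)] stays in place and the excess of [rho] moves along [f]. The
    balance hypothesis says that both measures agree on each orbit {x, f x}, so the excess at [f x]
    is exactly the deficit at [x]. The mass moved is half the l1 distance. *)
Lemma transport_involution (f : cube n -> cube n) rho nu :
  involutive f -> (forall x, dH R x (f x) <= 1) ->
  (forall x, 0 <= rho x) -> (forall x, 0 <= nu x) ->
  (forall x, rho x + rho (f x) = nu x + nu (f x)) ->
  transport rho nu (l1norm (fun x => rho x - nu x) / 2).
Proof.
move=> fK df r0 n0 bal.
pose mn x := Num.min (rho x) (nu x).
have mn0 x : 0 <= mn x by rewrite le_min r0 n0.
have mr x : mn x <= rho x by rewrite ge_min lexx.
pose p x y := (y == x)%:R * mn x + (y == f x)%:R * (rho x - mn x).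
have mflip y : rho (f y) - mn (f y) = nu y - mn y.
  have b := bal y; rewrite /mn !minr_absE.
  have -> : rho (f y) - nu (f y) = - (rho y - nu y) by lra.
  by rewrite normrN; lra.
exists p; split.
  split; first by move=> x y; rewrite addr_ge0 ?mulr_ge0 ?subr_ge0.
  split.
    move=> x; rewrite big_split /= (sum_delta (fun=> mn x)).
    by rewrite (sum_delta (fun=> rho x - mn x)) addrC subrK.
  move=> y; rewrite big_split /=.
  under eq_bigr do rewrite eq_sym.
  rewrite sum_delta.
  under eq_bigr => x _ do rewrite -(inj_eq (inv_inj fK)) fK eq_sym.
  by rewrite (sum_delta (fun x => rho x - mn x)) mflip addrC subrK.
have half : \sum_x (rho x - mn x) = l1norm (fun x => rho x - nu x) / 2.
  have e x : rho x - mn x = `|rho x - nu x| / 2 + (rho x - nu x) / 2.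
    by rewrite /mn minr_absE; lra.
  rewrite (eq_bigr _ (fun x _ => e x)) big_split /= -!mulr_suml.
  suff -> : \sum_x (rho x - nu x) = 0 by rewrite mul0r addr0.
  have s2 : \sum_x (rho x - nu x) = \sum_x (rho (f x) - nu (f x)).
    by rewrite (reindex_inj (inv_inj fK)).
  have : \sum_x (rho x - nu x) + \sum_x (rho (f x) - nu (f x)) = 0.
    rewrite -big_split big1// => x _ /=; have := bal x; lra.
  rewrite -s2; lra.
rewrite -half; apply: ler_sum => x _.
under eq_bigr do rewrite mulrDl -!mulrA.
rewrite big_split /= (sum_delta (fun y => mn x * dH R x y)).
rewrite (sum_delta (fun y => (rho x - mn x) * dH R x y)) dHxx mulr0 add0r.
by rewrite ler_piMr// subr_ge0.
Qed.

End Transport.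

Section Resampling.
Context {R : realType} {n : nat}.
Implicit Types (rho nu g : cube n -> R) (x y z : cube n) (c : R) (i j : 'I_n).

Definition flip i y : cube n := setc y i (~~ y i).

Lemma setcE y i b j : setc y i b j = if j == i then b else y j.
Proof. by rewrite ffunE. Qed.

Lemma flipE i y j : flip i y j = if j == i then ~~ y i else y j.
Proof. by rewrite setcE. Qed.

Lemma flipK i : involutive (flip i).
Proof.
move=> y; apply/ffunP => j; rewrite !flipE eqxx.
by case: eqP => [->|]; rewrite ?negbK.
Qed.

Lemma flipC i j y : flip i (flip j y) = flip j (flip i y).
Proof.
apply/ffunP => k; rewrite !flipE.
by case: (eqVneq k i) => [->|]; case: (eqVneq i j) => [->|]; case: (eqVneq k j).
Qed.

Lemma dH_flip i y : dH R y (flip i y) <= 1.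
Proof.
rewrite dH_sum (bigD1 i)//= big1 ?addr0; first by case: (_ != _); rewrite ?ler01.
by move=> j /negbTE ji; rewrite flipE ji eqxx.
Qed.

Lemma sum_flip i g : \sum_y g (flip i y) = \sum_y g y.
Proof. by rewrite [RHS](reindex_inj (inv_inj (flipK i))). Qed.

Variable q : 'I_n -> bool -> R.
Hypothesis q0 : forall i b, 0 <= q i b.
Hypothesis q1 : forall i b, q i b + q i (~~ b) = 1.

(** [g y + g (flip i y)] is the marginal mass of the other coordinates, so this is the law after
    redrawing coordinate [i] independently from [q i]. *)
Definition resample i g y : R := q i (y i) * (g y + g (flip i y)).

Lemma resample_ge0 i g : (forall y, 0 <= g y) -> forall y, 0 <= resample i g y.
Proof. by move=> g0 y; rewrite mulr_ge0// addr_ge0. Qed.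

Lemma resample_flip i g y : resample i g y + resample i g (flip i y) = g y + g (flip i y).
Proof.
rewrite /resample flipK flipE eqxx (addrC (g (flip i y))) -mulrDl q1.
by rewrite mul1r.
Qed.

Lemma resampleC i j g : resample i (resample j g) = resample j (resample i g).
Proof.
have [->//|ij] := eqVneq i j.
apply/funext => y; rewrite /resample !flipE (negbTE ij) eq_sym (negbTE ij).
rewrite (flipC i j); ring.
Qed.

Lemma resampleB i g g' :
  resample i (fun y => g y - g' y) = (fun y => resample i g y - resample i g' y).
Proof. by apply/funext => y; rewrite /resample; ring. Qed.

Lemma l1norm_resample i g : l1norm (resample i g) <= l1norm g.
Proof.
apply: (@le_trans _ _ (\sum_y resample i (fun y => `|g y|) y)).
  apply: ler_sum => y _; rewrite /resample normrM (ger0_norm (q0 _ _)).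
  by rewrite ler_wpM2l// ler_normD.
have h : \sum_y resample i (fun y => `|g y|) y + \sum_y resample i (fun y => `|g y|) y
    = l1norm g + l1norm g.
  rewrite -{2}(sum_flip i) -big_split /=.
  under eq_bigr do rewrite resample_flip.
  by rewrite big_split /= (sum_flip i (fun y => `|g y|)).
by rewrite /l1norm in h *; lra.
Qed.

Definition resamples (r : seq 'I_n) g := foldr resample g r.

Lemma resamples_ge0 r g : (forall y, 0 <= g y) -> forall y, 0 <= resamples r g y.
Proof. by move=> g0; elim: r => //= i r IH; exact: resample_ge0. Qed.

Lemma resamplesC r i g : resample i (resamples r g) = resamples r (resample i g).
Proof. by elim: r => //= j r IH; rewrite resampleC IH. Qed.

Lemma resamplesB r g g' :
  resamples r (fun y => g y - g' y) = (fun y => resamples r g y - resamples r g' y).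
Proof. by elim: r => //= j r ->; rewrite resampleB. Qed.

Lemma l1norm_resamples r g : l1norm (resamples r g) <= l1norm g.
Proof. by elim: r => //= j r IH; apply: le_trans (l1norm_resample _ _) IH. Qed.

(* Resampling operators commute and contract the l1 norm, so resampling i after
   other coordinates costs at most what it costs at the start. *)
Lemma transport_resamples r rho : (forall y, 0 <= rho y) ->
  transport rho (resamples r rho)
    (\sum_(i <- r) l1norm (fun y => rho y - resample i rho y) / 2).
Proof.
move=> rho0; elim: r => [|i r IH]; first by rewrite big_nil; exact: transport_refl.
rewrite big_cons addrC; apply: (transport_trans IH) => /=.
apply: transport_le (transport_involution (flipK i) (dH_flip i) _ _ _).
- rewrite ler_pM2r// resamplesC.
  by have := l1norm_resamples r (fun y => rho y - resample i rho y); rewrite resamplesB.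
- exact: resamples_ge0.
- by apply: resample_ge0; exact: resamples_ge0.
- by move=> y; rewrite resample_flip.
Qed.

(** The transition kernel of the composition: a redrawn coordinate contributes [q], an untouched one
    a delta. When [r] lists all coordinates the kernel forgets [z], and a product measure
    results. *)
Lemma resamplesE r g y : uniq r -> resamples r g y =
  \sum_(z : cube n) (\prod_i if i \in r then q i (y i) else (z i == y i)%:R) * g z.
Proof.
elim: r y => [|i r IH] y /=.
  move=> _; rewrite -[LHS](sum_delta g); apply: eq_bigr => z _; congr (_ * _).
  have [->|/eqP zy] := eqVneq z y; first by rewrite big1// => i _; rewrite eqxx.
  have [i /negbTE zi] : exists i, z i != y i.
    apply: contrapT => h; apply: zy; apply/ffunP => i; apply/eqP.
    by apply: contrapT => /negP hi; apply: h; exists i.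
  by rewrite (bigD1 i)//= zi mul0r.
move=> /andP[ir ur]; rewrite /resample !IH// -big_split mulr_sumr /=.
apply: eq_bigr => z _; rewrite -mulrDl mulrA; congr (_ * _).
rewrite (bigD1 i)//= (negbTE ir) [X in _ + X](bigD1 i)//= (negbTE ir).
rewrite [RHS](bigD1 i)//= inE eqxx /=.
have -> : \prod_(j | j != i) (if j \in r then q j (flip i y j) else (z j == flip i y j)%:R)
  = \prod_(j | j != i) (if j \in r then q j (y j) else (z j == y j)%:R) :> R.
  by apply: eq_bigr => j /negbTE ji; rewrite flipE ji.
have -> : \prod_(j | j != i) (if j \in i :: r then q j (y j) else (z j == y j)%:R)
  = \prod_(j | j != i) (if j \in r then q j (y j) else (z j == y j)%:R) :> R.
  by apply: eq_bigr => j /negbTE ji; rewrite inE ji.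
rewrite -mulrDl flipE eqxx mulrA; congr (_ * _).
by case: (z i); case: (y i); rewrite /= ?addr0 ?add0r mulr1.
Qed.

Lemma resamples_all g y :
  resamples (enum 'I_n) g y = (\prod_i q i (y i)) * \sum_z g z.
Proof.
rewrite resamplesE ?enum_uniq// mulr_sumr; apply: eq_bigr => z _.
by congr (_ * _); apply: eq_bigr => i _; rewrite mem_enum.
Qed.

End Resampling.

(** * Exponential tilts of finite measures *)

Section FiniteExpectation.
Context {R : realType} {Y : finType}.
Implicit Types (p g h x : Y -> R) (B eta : R).

Definition Ex p g : R := \sum_y p y * g y.
Definition Cov p g h : R := Ex p (fun y => g y * h y) - Ex p g * Ex p h.

Lemma ExD p g h : Ex p (fun y => g y + h y) = Ex p g + Ex p h.
Proof. by rewrite -big_split; apply: eq_bigr => y _; rewrite mulrDr. Qed.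

Lemma ExZ p c g : Ex p (fun y => c * g y) = c * Ex p g.
Proof. by rewrite /Ex mulr_sumr; apply: eq_bigr => y _; rewrite mulrCA. Qed.

Lemma Ex_sum p (I : Type) (r : seq I) (g : I -> Y -> R) :
  Ex p (fun y => \sum_(i <- r) g i y) = \sum_(i <- r) Ex p (g i).
Proof. by rewrite exchange_big; apply: eq_bigr => y _; rewrite mulr_sumr. Qed.

Variable p : Y -> R.
Hypothesis p0 : forall y, 0 <= p y.
Hypothesis p1 : \sum_y p y = 1.

Lemma Ex_cst c : Ex p (fun=> c) = c.
Proof. by rewrite /Ex -mulr_suml p1 mul1r. Qed.

Lemma Ex_le g h : (forall y, g y <= h y) -> Ex p g <= Ex p h.
Proof. by move=> gh; apply: ler_sum => y _; rewrite ler_wpM2l. Qed.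

Lemma Ex_norm_le g B : (forall y, `|g y| <= B) -> `|Ex p g| <= B.
Proof.
move=> gB; rewrite -[leRHS]Ex_cst; apply: (le_trans (ler_norm_sum _ _ _)).
by apply: ler_sum => y _; rewrite normrM ger0_norm// ler_wpM2l.
Qed.

(** Covariance through two independent copies: pointwise comparisons of increments become
    inequalities between covariances. *)
Lemma CovE g h :
  Cov p g h = 2^-1 * \sum_y \sum_z p y * p z * ((g y - g z) * (h y - h z)).
Proof.
have e y : \sum_z p y * p z * ((g y - g z) * (h y - h z)) =
    p y * (g y * h y) - p y * g y * Ex p h - p y * h y * Ex p g
      + p y * Ex p (fun z => g z * h z).
  have -> : p y * (g y * h y) = \sum_z p y * p z * (g y * h y).
    by rewrite -mulr_suml -mulr_sumr p1 mulr1.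
  rewrite /Ex !mulr_sumr -!sumrB -big_split /=.
  by apply: eq_bigr => z _; ring.
rewrite (eq_bigr _ (fun y _ => e y)) !big_split /= !sumrN -!mulr_suml p1.
rewrite /Cov /Ex; move: (\sum_y _) (\sum_y _) (\sum_y _) => a b c; by field.
Qed.

Lemma Var_le_Cov g h K : (forall y z, (h y - h z) ^+ 2 <= K * ((g y - g z) * (h y - h z))) ->
  Cov p h h <= K * Cov p g h.
Proof.
move=> H; rewrite !CovE mulrCA ler_pM2l// mulr_sumr.
apply: ler_sum => y _; rewrite mulr_sumr; apply: ler_sum => z _.
by rewrite [leRHS]mulrCA ler_wpM2l ?mulr_ge0// -expr2.
Qed.

Lemma Cov_ge0 g h : (forall y z, 0 <= (g y - g z) * (h y - h z)) -> 0 <= Cov p g h.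
Proof.
move=> H; rewrite CovE mulr_ge0//.
by apply: sumr_ge0 => y _; apply: sumr_ge0 => z _; rewrite mulr_ge0// mulr_ge0.
Qed.

Lemma Cov_le0_eq g h : (forall y, 0 < p y) ->
  (forall y z, 0 <= (g y - g z) * (h y - h z)) -> Cov p g h <= 0 ->
  forall y z, (g y - g z) * (h y - h z) = 0.
Proof.
move=> pp H; rewrite CovE pmulr_rle0// => C0 y z.
have n0 a b : 0 <= p a * p b * ((g a - g b) * (h a - h b)).
  by rewrite mulr_ge0// mulr_ge0.
have : p y * p z * ((g y - g z) * (h y - h z)) <= 0.
  apply: le_trans C0.
  rewrite [leRHS](bigD1 y)//= (bigD1 z)//= -addrA lerDl.
  apply: addr_ge0; apply: sumr_ge0 => a _; first exact: n0.
  by apply: sumr_ge0 => b _; exact: n0.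
by rewrite pmulr_rle0 ?mulr_gt0// => h0; apply/eqP; rewrite eq_le h0 H.
Qed.

Lemma Cov_self g : Cov p g g = Ex p (fun y => (g y - Ex p g) ^+ 2).
Proof.
have e y : (g y - Ex p g) ^+ 2 = g y * g y + ((- 2 * Ex p g) * g y + Ex p g ^+ 2).
  by ring.
under [RHS]eq_bigr do rewrite e.
rewrite -/(Ex p _) ExD ExD ExZ Ex_cst /Cov; ring.
Qed.

Definition tilt x y : R := p y * expR (x y) / \sum_z p z * expR (x z).

Hypothesis p_gt0 : forall y, 0 < p y.

Lemma partition_gt0 x : 0 < \sum_z p z * expR (x z).
Proof.
rewrite lt_neqAle sumr_ge0 ?andbT; last by move=> y _; rewrite mulr_ge0 ?expR_ge0.
apply/eqP => /esym/psumr_eq0P h.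
have : \sum_y p y = 0.
  apply: big1 => y _; have /eqP := h (fun y _ => mulr_ge0 (p0 y) (expR_ge0 _)) y isT.
  by rewrite mulf_eq0 (gt_eqF (expR_gt0 _)) orbF => /eqP.
by rewrite p1 => /eqP; rewrite oner_eq0.
Qed.

Lemma tilt_gt0 x y : 0 < tilt x y.
Proof. by rewrite divr_gt0 ?mulr_gt0 ?expR_gt0// partition_gt0. Qed.

Lemma tilt_sum x : \sum_y tilt x y = 1.
Proof. by rewrite -mulr_suml divff// gt_eqF// partition_gt0. Qed.

(** The upper bound follows from e^u (1 - u) <= 1 <= (1 + u + 2u^2)(1 - u), where the second
    inequality is u^2 (1 - 2u) >= 0. *)
Lemma expR_taylor1 (u : R) : `|u| <= 1 / 2 -> `|expR u - 1 - u| <= 2 * u ^+ 2.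
Proof.
rewrite ler_norml => /andP[u1 u2].
have l := expR_ge1Dx u; have l' := expR_ge1Dx (- u).
have hu : expR u * expR (- u) = 1 by rewrite -expRD subrr expR0.
have h : expR u * (1 - u) <= 1.
  by rewrite -[leRHS]hu ler_wpM2l ?expR_ge0.
have h2 : expR u * (1 - u) <= (1 + u + 2 * u ^+ 2) * (1 - u).
  apply: (le_trans h); have := sqr_ge0 u; nra.
have h3 : expR u <= 1 + u + 2 * u ^+ 2 by rewrite -(@ler_pM2r _ (1 - u))//; lra.
by have := sqr_ge0 u; rewrite ler_norml; lra.
Qed.

(* With M = E e^x: M (E' g - E g - Cov(g, x))
   = E[(g - E g)(e^x - 1 - x)] - Cov(g, x) (M - 1). *)
Lemma tilt_Taylor x g B eta : eta <= 1 / 2 -> (forall y, `|x y| <= eta) ->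
  (forall y, `|g y| <= B) ->
  `|Ex (tilt x) g - Ex p g - Cov p g x| <= 16 * B * eta ^+ 2.
Proof.
move=> e2 xe gB; pose M := Ex p (fun y => expR (x y)).
have [y _|Y0] := pickP (@predT Y); last first.
  by move: p1; rewrite big_pred0// => /esym/eqP; rewrite oner_eq0.
have e0 : 0 <= eta by apply: le_trans (xe y).
have B0 : 0 <= B by apply: le_trans (gB y).
pose gb := Ex p g.
have gbB : `|gb| <= B by exact: Ex_norm_le.
have gg z : `|g z - gb| <= 2 * B.
  by apply: (le_trans (ler_normB _ _)); have := gB z; lra.
have xe2 z : `|x z| <= 1 / 2 by exact: le_trans (xe z) e2.
have x2 z : x z ^+ 2 <= eta ^+ 2.
  by rewrite -real_normK ?num_real// lerXn2r ?nnegrE.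
have T z : `|expR (x z) - 1 - x z| <= 2 * eta ^+ 2.
  by apply: (le_trans (expR_taylor1 (xe2 z))); rewrite ler_pM2l.
have T1 z : `|expR (x z) - 1| <= 2 * eta.
  have -> : expR (x z) - 1 = (expR (x z) - 1 - x z) + x z by rewrite subrK.
  apply: (le_trans (ler_normD _ _)); have := T z; have := xe z; nra.
have M1 : `|M - 1| <= 2 * eta.
  have -> : M - 1 = Ex p (fun z => expR (x z) + (-1)) by rewrite ExD Ex_cst.
  exact: Ex_norm_le.
have M2 : 1 / 2 <= M.
  have : Ex p (fun z => 1 + x z) <= M by apply: Ex_le => z; exact: expR_ge1Dx.
  rewrite ExD Ex_cst; have : `|Ex p x| <= 1 / 2 by exact: Ex_norm_le.
  by rewrite ler_norml; lra.
have M0 : 0 < M by lra.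
have EM : Ex (tilt x) g = Ex p (fun y => g y * expR (x y)) / M.
  rewrite /Ex mulr_suml; apply: eq_bigr => z _.
  by rewrite /tilt -/(Ex p (fun y => expR (x y))) -/M; ring.
have CE : Cov p g x = Ex p (fun y => (g y - gb) * x y).
  rewrite /Cov -/gb -ExZ -mulN1r -ExZ -ExD; apply: eq_bigr => z _; ring.
pose A1 := Ex p (fun y => (g y - gb) * (expR (x y) - 1 - x y)).
have A1E : A1 = Ex p (fun y => g y * expR (x y)) - gb * M - Cov p g x.
  rewrite CE.
  have -> : A1 = Ex p (fun y => (g y * expR (x y) + (- gb) * expR (x y)) +
      ((- 1) * g y + (gb + (-1) * ((g y - gb) * x y)))).
    by apply: eq_bigr => z _; ring.
  rewrite !ExD !ExZ Ex_cst -/gb -/M; ring.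
have A1B : `|A1| <= 2 * B * (2 * eta ^+ 2).
  by apply: Ex_norm_le => z; rewrite normrM ler_pM.
have CB : `|Cov p g x| <= 2 * B * eta.
  by rewrite CE; apply: Ex_norm_le => z; rewrite normrM ler_pM.
have id : (Ex (tilt x) g - gb - Cov p g x) * M = A1 - Cov p g x * (M - 1).
  rewrite A1E EM; field; exact: lt0r_neq0.
(* 4B eta^2 from [A1B] and 2B eta * 2 eta from the other term; dividing by M >= 1/2 then gives the
   constant 16. *)
have : `|Ex (tilt x) g - gb - Cov p g x| * M <= 8 * B * eta ^+ 2.
  rewrite -[X in _ * X <= _](gtr0_norm M0) -normrM id; apply: (le_trans (ler_normB _ _)).
  rewrite normrM.
  have : `|Cov p g x| * `|M - 1| <= 2 * B * eta * (2 * eta) by rewrite ler_pM.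
  by rewrite expr2 in A1B *; lra.
have := normr_ge0 (Ex (tilt x) g - gb - Cov p g x).
by rewrite -/gb; move: (`|_|) => a; nra.
Qed.

End FiniteExpectation.

(** * Distance to the product measure *)

Section ProductApproximation.
Context {R : realType} {n : nat}.
Variable rho : cube n -> R.
Hypothesis rho_prob : is_prob rho.
Hypothesis rho_gt0 : forall y, 0 < rho y.
Implicit Types (i : 'I_n) (y : cube n) (a : cube n -> R).

Definition spin i y : R := sgnb R (y i).

Lemma spin_flip i y : spin i (flip i y) = - spin i y.
Proof. by rewrite /spin flipE eqxx; case: (y i); rewrite /sgnb /= ?opprK. Qed.

Lemma spin_sq i y : spin i y * spin i y = 1.
Proof. by rewrite /spin; case: (y i); rewrite /sgnb /= ?mulrNN mulr1. Qed.

Lemma norm_spin i y : `|spin i y| = 1.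
Proof. by rewrite /spin; case: (y i); rewrite /sgnb /= ?normrN normr1. Qed.

(* the conditional expectation of the i-th coordinate given the others *)
Definition cmean i y : R :=
  spin i y * (rho y - rho (flip i y)) / (rho y + rho (flip i y)).

Lemma cmean_flip i y : cmean i (flip i y) = cmean i y.
Proof. by rewrite /cmean spin_flip flipK; congr (_ / _); [ring|exact: addrC]. Qed.

Lemma cmean_mul i y :
  cmean i y * (rho y + rho (flip i y)) = spin i y * (rho y - rho (flip i y)).
Proof. by rewrite /cmean divfK// gt_eqF// addr_gt0. Qed.

(** Conditioning on the other coordinates: [a] is constant on each pair {y, flip i y}, where the
    spin averages to [cmean i]. *)
Lemma Ex_spin i a : (forall y, a (flip i y) = a y) ->
  Ex rho (fun y => a y * spin i y) = Ex rho (fun y => a y * cmean i y).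
Proof.
move=> af.
have dbl b : 2 * Ex rho b = \sum_y (rho y * b y + rho (flip i y) * b (flip i y)).
  by rewrite big_split /= (sum_flip i (fun y => rho y * b y)) -mulr2n mulr_natl.
apply: (@mulfI _ 2) => //; rewrite !dbl; apply: eq_bigr => y _.
rewrite af spin_flip cmean_flip -mulrDl [RHS]mulrC -mulrA cmean_mul; ring.
Qed.

Lemma meanv_cmean i : Ex rho (spin i) = Ex rho (cmean i).
Proof.
have := @Ex_spin i (fun=> 1) (fun=> erefl).
by under eq_fun do rewrite mul1r; move=> ->; under eq_fun do rewrite mul1r.
Qed.

Lemma meanvE i : meanv rho i = Ex rho (spin i).
Proof. by []. Qed.

Definition coord_law (i : 'I_n) (b : bool) : R := (1 + sgnb R b * meanv rho i) / 2.

Lemma meanv_norm_le i : `|meanv rho i| <= 1.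
Proof.
have [r0 r1] := rho_prob; rewrite meanvE; apply: Ex_norm_le => // y.
by rewrite norm_spin.
Qed.

Lemma coord_law_ge0 i b : 0 <= coord_law i b.
Proof.
have := meanv_norm_le i; rewrite ler_norml /coord_law /sgnb => /andP[h1 h2].
by rewrite divr_ge0//; case: b; lra.
Qed.

Lemma coord_law_sum i b : coord_law i b + coord_law i (~~ b) = 1.
Proof. by rewrite /coord_law /sgnb; case: b => /=; field. Qed.

(** On a pair {y, flip i y} of mass m, the split of m is determined by the conditional mean of
    coordinate [i]: [cmean i y] before resampling, [meanv rho i] after. Each of the two points
    therefore changes by m |cmean - meanv| / 2. *)
Lemma resample_cost i :
  l1norm (fun y => rho y - resample coord_law i rho y) / 2 =
  Ex rho (fun y => `|cmean i y - meanv rho i|) / 2.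
Proof.
congr (_ / 2); pose b y := `|cmean i y - meanv rho i|.
have e y : `|rho y - resample coord_law i rho y| =
    (rho y * b y + rho (flip i y) * b (flip i y)) / 2.
  rewrite /b cmean_flip -mulrDl.
  have s0 : 0 < rho y + rho (flip i y) by rewrite addr_gt0.
  have -> : rho y - resample coord_law i rho y =
      spin i y * ((rho y + rho (flip i y)) * (cmean i y - meanv rho i)) / 2.
    have -> : spin i y * ((rho y + rho (flip i y)) * (cmean i y - meanv rho i)) =
        (spin i y * spin i y) * (rho y - rho (flip i y)) -
        spin i y * (rho y + rho (flip i y)) * meanv rho i.
      by rewrite -[_ * _ * (rho y - _)]mulrA -cmean_mul; ring.
    by rewrite spin_sq mul1r /resample /coord_law -/(spin i y); field.
  by rewrite !normrM norm_spin mul1r (gtr0_norm s0) [`|2^-1|]gtr0_norm.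
rewrite /l1norm (eq_bigr _ (fun y _ => e y)) -mulr_suml big_split /=.
rewrite (sum_flip i (fun y => rho y * b y)) /Ex; by field.
Qed.

(** A law on {-1,1} is determined by its mean; hence a product measure with the means of [rho] is
    the product of the [coord_law rho i]. *)
Lemma margJ1 (xi : cube n -> R) i y : is_prob xi ->
  margJ xi [set i] y = (1 + sgnb R (y i) * meanv xi i) / 2.
Proof.
move=> [x0 x1]; rewrite /margJ /meanv big_mkcond /=.
have -> : 1 + sgnb R (y i) * \sum_z xi z * sgnb R (z i) =
    \sum_z (xi z + sgnb R (y i) * (xi z * sgnb R (z i))).
  by rewrite big_split /= x1 mulr_sumr.
rewrite mulr_suml; apply: eq_bigr => z _.
have -> : [forall j in [set i]%SET, z j == y j] = (z i == y i).
  apply/forall_inP/idP => [h|/eqP h j]; first by apply: h; rewrite inE.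
  by rewrite inE => /eqP ->; apply/eqP.
by case: (z i); case: (y i); rewrite /sgnb /=; field.
Qed.

Lemma transport_product (xi : cube n -> R) :
  is_prob xi -> is_product xi -> meanv xi = meanv rho ->
  transport rho xi ((\sum_i Ex rho (fun y => `|cmean i y - meanv rho i|)) / 2).
Proof.
move=> xp xprod xm; have [r0 r1] := rho_prob.
have -> : xi = resamples coord_law (enum 'I_n) rho.
  apply/funext => y; rewrite resamples_all r1 mulr1 xprod.
  by apply: eq_bigr => i _; rewrite margJ1// xm.
have := transport_resamples coord_law_ge0 coord_law_sum (enum 'I_n) r0.
under eq_bigr do rewrite resample_cost.
by rewrite big_enum /= mulr_suml.
Qed.

(** Cauchy-Schwarz over coordinates and points jointly: the sum of E(a_i - t)^2 is nonnegative, and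
    the choice t = T/n minimizes it. *)
Lemma sum_Ex_le_sqrt (a : 'I_n -> cube n -> R) :
  \sum_i Ex rho (a i) <= Num.sqrt (n%:R * \sum_i Ex rho (fun y => a i y ^+ 2)).
Proof.
have [r0 r1] := rho_prob.
set T := \sum_i _; set S := \sum_i _.
have [n0|n0] := posnP n.
  rewrite {1}/T big1 ?sqrtr_ge0// => i _; have := ltn_ord i; by rewrite {2}n0.
have nn0 : 0 < n%:R :> R by rewrite ltr0n.
have H t : 0 <= S + ((- 2 * t) * T + n%:R * t ^+ 2).
  have -> : S + ((- 2 * t) * T + n%:R * t ^+ 2) =
      \sum_i Ex rho (fun y => (a i y - t) ^+ 2).
    have e i : Ex rho (fun y => (a i y - t) ^+ 2) =
        Ex rho (fun y => a i y ^+ 2) + ((- 2 * t) * Ex rho (a i) + t ^+ 2).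
      rewrite -ExZ -[t ^+ 2 in RHS](Ex_cst r1) -!ExD.
      by apply: eq_bigr => y _; ring.
    rewrite (eq_bigr _ (fun i _ => e i)) !big_split /= -mulr_sumr.
    by rewrite sumr_const card_ord mulr_natl.
  apply: sumr_ge0 => i _; apply: sumr_ge0 => y _.
  by rewrite mulr_ge0 ?sqr_ge0.
apply: (le_trans (ler_norm _)); rewrite -sqrtr_sqr ler_wsqrtr//.
have := H (T / n%:R).
have -> : S + (- 2 * (T / n%:R) * T + n%:R * (T / n%:R) ^+ 2) = S - T ^+ 2 / n%:R.
  by field; rewrite gt_eqF.
by rewrite subr_ge0 ler_pdivrMr// mulrC.
Qed.

Lemma W1_product_le (xi : cube n -> R) :
  is_prob xi -> is_product xi -> meanv xi = meanv rho ->
  W1 rho xi <= Num.sqrt (n%:R * \sum_i Cov rho (cmean i) (cmean i)) / 2.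
Proof.
move=> xp xprod xm; apply: (le_trans (W1_le (transport_product xp xprod xm))).
rewrite ler_pM2r//; apply: (le_trans (sum_Ex_le_sqrt _)).
rewrite le_eqVlt; apply/orP; left; apply/eqP; congr (Num.sqrt (_ * _)).
have [r0 r1] := rho_prob.
apply: eq_bigr => i _; rewrite Cov_self//; apply: eq_bigr => y _.
congr (_ * _); rewrite real_normK ?num_real//; congr ((_ - _) ^+ 2).
by rewrite meanvE meanv_cmean.
Qed.

End ProductApproximation.

(** * Monotonicity and Lipschitz bound of the hyperbolic tangent *)

Section Tanh.
Context {R : realType}.
Implicit Types a b : R.

Definition tanhR a : R := 1 - 2 / (expR (2 * a) + 1).

Let den_gt0 a : 0 < expR (2 * a) + 1.
Proof. by rewrite addr_gt0 ?expR_gt0. Qed.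

Lemma tanhR_lt a b : b < a -> tanhR b < tanhR a.
Proof.
move=> ba; rewrite /tanhR ltrD2l ltrN2 ltr_pM2l// ltf_pV2 ?posrE//.
by rewrite ltrD2r ltr_expR ltr_pM2l.
Qed.

Lemma tanhR_inj : injective tanhR.
Proof.
by move=> a b ab; case: (ltgtP a b) => // /tanhR_lt; rewrite ab ltxx.
Qed.

(** The sharp constant is 1. Here e^{2a} - e^{2b} <= 2 e^{2a} (a - b), from 1 + x <= e^x, is
    inserted into the quotient form of the difference, whose denominator exceeds e^{2a}. *)
Lemma tanhR_lip a b : b <= a -> tanhR a - tanhR b <= 4 * (a - b).
Proof.
move=> ba; rewrite /tanhR.
set u := expR (2 * a); set v := expR (2 * b).
have u0 : 0 < u by exact: expR_gt0.
have v0 : 0 < v by exact: expR_gt0.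
have vu : v = u * expR (- (2 * (a - b))) by rewrite -expRD; congr expR; ring.
have h : u - v <= u * (2 * (a - b)).
  rewrite vu -{1}(mulr1 u) -mulrBr ler_pM2l//.
  have := expR_ge1Dx (- (2 * (a - b))); lra.
have -> : 1 - 2 / (u + 1) - (1 - 2 / (v + 1)) = 2 * (u - v) / ((v + 1) * (u + 1)).
  by field; rewrite !gt_eqF ?addr_gt0.
rewrite ler_pdivrMr ?mulr_gt0 ?addr_gt0//.
have p : 0 <= (a - b) * (v * u + v + 1) by rewrite mulr_ge0 ?subr_ge0// !addr_ge0 ?mulr_ge0 ?ltW.
nra.
Qed.

Lemma tanhR_sq_le a b : (tanhR a - tanhR b) ^+ 2 <= 4 * ((a - b) * (tanhR a - tanhR b)).
Proof.
wlog ba : a b / b <= a => [H|].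
  case: (leP b a) => [|/ltW] /H// h.
  have -> : (tanhR a - tanhR b) ^+ 2 = (tanhR b - tanhR a) ^+ 2 by ring.
  by apply: (le_trans h); rewrite ler_pM2l// -mulrNN !opprB.
have t0 : 0 <= tanhR a - tanhR b.
  by rewrite subr_ge0; move: ba; rewrite le_eqVlt => /predU1P[->//|/tanhR_lt/ltW].
by rewrite expr2 mulrA ler_wpM2r// tanhR_lip.
Qed.

End Tanh.

(** * Bounded Lipschitz functions of the Gaussian coordinates *)

Section BoundedLipschitz.
Context {R : realType} {k : nat}.
Implicit Types (F G : seq R -> R).

(** Unlike [qLip], this class is closed under products, as covariances require; multiplying once by
    a coordinate still lands in [qLip]. *)
Definition bLip F : Prop := exists2 L, 0 <= L &
  (forall s, `|F s| <= L) /\ (forall s s', `|F s - F s'| <= L * dist1 k s s').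

Lemma bLip_qLip F : bLip F -> qLip k F.
Proof. by move=> [L _ [_ h]]; exact: qLip_Lipschitz h. Qed.

Lemma bLipD F G : bLip F -> bLip G -> bLip (fun s => F s + G s).
Proof.
move=> [L L0 [FL FL']] [M M0 [GM GM']]; exists (L + M); first by rewrite addr_ge0.
split=> [s|s s']; first by rewrite (le_trans (ler_normD _ _))// lerD.
by rewrite opprD addrACA mulrDl (le_trans (ler_normD _ _))// lerD.
Qed.

Lemma bLipZ c F : bLip F -> bLip (fun s => c * F s).
Proof.
move=> [L L0 [FL FL']]; exists (`|c| * L); first by rewrite mulr_ge0.
by split=> [s|s s']; rewrite -?mulrBr normrM -?mulrA ler_wpM2l.
Qed.

Lemma bLipM F G : bLip F -> bLip G -> bLip (fun s => F s * G s).
Proof.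
move=> [L L0 [FL FL']] [M M0 [GM GM']]; exists (2 * (L * M)).
  by rewrite !mulr_ge0.
split=> [s|s s'].
  rewrite normrM; apply: (@le_trans _ _ (L * M)); first by rewrite ler_pM.
  by rewrite ler_peMl ?mulr_ge0// ler1n.
have -> : F s * G s - F s' * G s' = F s * (G s - G s') + (F s - F s') * G s'.
  by ring.
apply: (le_trans (ler_normD _ _)); rewrite !normrM.
have h1 : `|F s| * `|G s - G s'| <= L * (M * dist1 k s s') by rewrite ler_pM.
have h2 : `|F s - F s'| * `|G s'| <= L * dist1 k s s' * M by rewrite ler_pM.
by lra.
Qed.

Lemma qLip_coordM i F : (i < k)%N -> bLip F -> qLip k (fun s => nth 0 s i * F s).
Proof.
move=> ik [L L0 [FL FL']]; exists L => // s s'.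
have -> : nth 0 s i * F s - nth 0 s' i * F s' =
    (nth 0 s i - nth 0 s' i) * F s + nth 0 s' i * (F s - F s') by ring.
have h1 : `|nth 0 s i - nth 0 s' i| <= dist1 k s s'.
  by rewrite /dist1 (bigD1 (Ordinal ik))//= lerDl sumr_ge0.
have h2 : `|nth 0 s' i| <= norm1 k s'.
  by rewrite /norm1 (bigD1 (Ordinal ik))//= lerDl sumr_ge0.
apply: (le_trans (ler_normD _ _)); rewrite !normrM.
have h3 : `|nth 0 s i - nth 0 s' i| * `|F s| <= dist1 k s s' * L by rewrite ler_pM.
have h4 : `|nth 0 s' i| * `|F s - F s'| <= norm1 k s' * (L * dist1 k s s').
  by rewrite ler_pM.
have h5 : 0 <= L * norm1 k s * dist1 k s s'.
  by rewrite !mulr_ge0 ?norm1_ge0 ?dist1_ge0.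
by lra.
Qed.

End BoundedLipschitz.

(** * Random tilts and the gradient complexity *)

Section ExponentialTilt.
Context {R : realType} {n : nat}.
Variable nu : cube n -> R.
Hypothesis nu_prob : is_prob nu.
Hypothesis nu_gt0 : forall y, 0 < nu y.
Variable delta : R.
Hypothesis delta_gt0 : 0 < delta.
Hypothesis delta_le : delta <= 1 / 2.
Implicit Types (s : seq R) (i : 'I_n) (y : cube n) (g : cube n -> R).

Let nu0 : forall y, 0 <= nu y := nu_prob.1.
Let nu1 : \sum_y nu y = 1 := nu_prob.2.

Definition potential s y : R := delta * \sum_(j < n) nth 0 s j * spin j y.

Definition tilted s : cube n -> R := tilt nu (potential s).

Lemma tilted_gt0 s y : 0 < tilted s y.
Proof. exact: tilt_gt0. Qed.

Lemma tilted_ge0 s y : 0 <= tilted s y.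
Proof. exact/ltW/tilted_gt0. Qed.

Lemma tilted_sum s : \sum_y tilted s y = 1.
Proof. exact: tilt_sum. Qed.

Lemma tilted_prob s : is_prob (tilted s).
Proof. by split; [exact: tilted_ge0|exact: tilted_sum]. Qed.

(** Tilts compose, so [tilt_Taylor], an expansion around the base measure, applies around every
    [tilted s]. *)
Lemma tiltedE s s' : tilted s' = tilt (tilted s) (fun y => potential s' y - potential s y).
Proof.
apply/funext => y; rewrite [RHS]/tilt.
pose Z := \sum_z nu z * expR (potential s z).
have Z0 : 0 < Z by exact: partition_gt0.
have e z : tilted s z * expR (potential s' z - potential s z) = nu z * expR (potential s' z) / Z.
  rewrite /tilted /tilt -/Z mulrAC; congr (_ / _).
  by rewrite -mulrA -expRD; congr (_ * expR _); rewrite addrC subrK.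
rewrite (eq_bigr _ (fun z _ => e z)) e -mulr_suml /tilted /tilt.
have := partition_gt0 nu0 nu1 (potential s') => Z'0.
by field; rewrite !gt_eqF.
Qed.

Lemma potential_dist s s' y : `|potential s' y - potential s y| <= delta * dist1 n s s'.
Proof.
rewrite /potential -mulrBr normrM gtr0_norm// ler_pM2l// -sumrB.
apply: (le_trans (ler_norm_sum _ _ _)); apply: ler_sum => j _.
by rewrite -mulrBl normrM norm_spin mulr1 distrC.
Qed.

Lemma potential_bump i h s y : potential (bump_nth i h s) y - potential s y = delta * h * spin i y.
Proof.
rewrite /potential -mulrBr -sumrB -mulrA; congr (_ * _).
rewrite (bigD1 i)//= big1 ?addr0 => [|j ji].
  by rewrite /bump_nth nth_set_nth /= eqxx; ring.
have {}ji : (j == i :> nat) = false by exact: negbTE.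
by rewrite /bump_nth nth_set_nth /= ji subrr.
Qed.

Lemma Ex_tilted_bLip g : bLip (k := n) (fun s => Ex (tilted s) g).
Proof.
pose B := \sum_y `|g y|.
have gB y : `|g y| <= B by rewrite /B (bigD1 y)//= lerDl sumr_ge0.
have B0 : 0 <= B by rewrite sumr_ge0.
have EB s : `|Ex (tilted s) g| <= B.
  by apply: Ex_norm_le gB; [exact: tilted_ge0|exact: tilted_sum].
(* For d <= 1/2 the covariance contributes 2Bd and the Taylor remainder 16Bd^2 <= 8Bd; for larger d
   the trivial bound 2B <= 4Bd is enough. *)
exists (10 * B); first by rewrite mulr_ge0.
split=> [s|s s']; first by apply: (le_trans (EB s)); lra.
set d := dist1 n s s'; have d0 : 0 <= d by exact: dist1_ge0.
have [dl|dg] := leP d (1 / 2); last first.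
  apply: (le_trans (ler_normB _ _)); have := EB s; have := EB s'.
  have : B * (1 / 2) <= B * d by rewrite ler_wpM2l// ltW.
  by lra.
have xd y : `|potential s' y - potential s y| <= d.
  apply: (le_trans (potential_dist _ _ _)); rewrite -/d ler_piMl//. apply: (le_trans delta_le); lra.
have := tilt_Taylor (tilted_ge0 s) (tilted_sum s) dl xd gB.
rewrite -tiltedE => T.
have C1 : `|Cov (tilted s) g (fun y => potential s' y - potential s y)| <= 2 * B * d.
  apply: (le_trans (ler_normB _ _)).
  have h1 : `|Ex (tilted s) (fun y => g y * (potential s' y - potential s y))| <= B * d.
    apply: Ex_norm_le; [exact: tilted_ge0|exact: tilted_sum|] => y.
    by rewrite normrM ler_pM.
  have h2 : `|Ex (tilted s) g * Ex (tilted s) (fun y => potential s' y - potential s y)| <= B * d.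
    rewrite normrM ler_pM//.
    by apply: Ex_norm_le; [exact: tilted_ge0|exact: tilted_sum|].
  by lra.
have d2 : B * d ^+ 2 <= B * (d * (1 / 2)) by rewrite ler_wpM2l// expr2 ler_wpM2l.
rewrite distrC.
have -> : Ex (tilted s') g - Ex (tilted s) g =
   (Ex (tilted s') g - Ex (tilted s) g - Cov (tilted s) g (fun y => potential s' y - potential s y))
   + Cov (tilted s) g (fun y => potential s' y - potential s y) by rewrite subrK.
by apply: (le_trans (ler_normD _ _)); lra.
Qed.

Lemma Cov_tilted_bLip g h : bLip (k := n) (fun s => Cov (tilted s) g h).
Proof.
rewrite /Cov; under eq_fun do rewrite -mulN1r.
apply: bLipD; first exact: Ex_tilted_bLip.
by apply/bLipZ/bLipM; exact: Ex_tilted_bLip.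
Qed.

(** Moving the i-th Gaussian coordinate by h tilts the measure by [delta * h * spin i], so the
    derivative of the tilted mean of [g] is [delta] times its covariance with [spin i]. *)
Lemma gEn_spin_ibp i g :
  gEn n (fun s => nth 0 s i * Ex (tilted s) g) =
  delta * gEn n (fun s => Cov (tilted s) g (spin i)).
Proof.
have bE := Ex_tilted_bLip g; have bC := Cov_tilted_bLip g (spin i).
rewrite -gEnZ; last exact: bLip_qLip.
have [B B0 [EB _]] := bE; have [B' B'0 [CB _]] := bLipZ delta bC.
pose G := \sum_y `|g y|.
have gG y : `|g y| <= G by rewrite /G (bigD1 y)//= lerDl sumr_ge0.
apply: (@gEn_ibp R n i _ _ B B' (16 * G * delta ^+ 2)) => //.
- exact: bLip_qLip.
- exact/bLip_qLip/bLipZ.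
- exact: qLip_coordM.
move=> s h h1.
have xb y : `|potential (bump_nth i h s) y - potential s y| <= delta * `|h|.
  by rewrite potential_bump !normrM norm_spin mulr1 gtr0_norm.
have dh : delta * `|h| <= 1 / 2.
  by apply: le_trans delta_le; rewrite ler_piMr// ltW.
have := tilt_Taylor (tilted_ge0 s) (tilted_sum s) dh xb gG.
rewrite -tiltedE exprMn real_normK ?num_real// [leRHS]mulrA.
suff -> : Cov (tilted s) g (fun y => potential (bump_nth i h s) y - potential s y) =
  h * (delta * Cov (tilted s) g (spin i)) by [].
have -> : (fun y => potential (bump_nth i h s) y - potential s y) = (fun y => (h * delta) * spin i y).
  by apply/funext => y; rewrite potential_bump (mulrC h).
rewrite /Cov ExZ.
have -> : Ex (tilted s) (fun y => g y * (h * delta * spin i y)) =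
    h * delta * Ex (tilted s) (fun y => g y * spin i y).
  by rewrite -ExZ; apply: eq_bigr => y _; ring.
by ring.
Qed.

Let grad i : cube n -> R := dpart (logdens nu) i.

Lemma setc_flip y i b : setc (flip i y) i b = setc y i b.
Proof. by apply/ffunP => j; rewrite !setcE; case: eqP => // /eqP/negbTE ji; rewrite flipE ji. Qed.

Lemma grad_flip i y : grad i (flip i y) = grad i y.
Proof. by rewrite /grad /dpart !setc_flip. Qed.

Lemma tilted_ratio s i y : tilted s (setc y i true) =
  tilted s (setc y i false) * expR (2 * (grad i y + delta * nth 0 s i)).
Proof.
rewrite /tilted /tilt; set Z := \sum_z _; rewrite [RHS]mulrAC; congr (_ / _).
have m0 : 0 < (@mu_unif R n y)^-1 by rewrite invr_gt0 invr_gt0 exprn_gt0.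
have nuE z : nu z = mu_unif R y * expR (logdens nu z).
  rewrite /logdens lnK; first by rewrite mulrC divfK// gt_eqF// -invr_gt0.
  by rewrite posrE divr_gt0// -invr_gt0.
have fE : potential s (setc y i true) = potential s (setc y i false) + 2 * (delta * nth 0 s i).
  rewrite /potential (bigD1 i)//= [in RHS](bigD1 i)//=.
  rewrite {1}/spin {2}/spin !setcE eqxx /sgnb.
  have -> : \sum_(j < n | j != i) nth 0 s j * spin j (setc y i true) =
      \sum_(j < n | j != i) nth 0 s j * spin j (setc y i false).
    by apply: eq_bigr => j /negbTE ji; rewrite /spin !setcE ji.
  by ring.
rewrite !nuE -!mulrA -!expRD; congr (_ * expR _).
by rewrite fE /grad /dpart; field.
Qed.

(** A law on {-1,1} with odds e^{2u} has mean tanh u. *)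
Lemma cmean_tilted s i y :
  cmean (tilted s) i y = tanhR (grad i y + delta * nth 0 s i).
Proof.
set u := _ + _.
have w0 : 0 < tilted s (setc y i false) by exact: tilted_gt0.
have e0 : 0 < expR (2 * u) by exact: expR_gt0.
have r := tilted_ratio s i y; rewrite -/u in r.
have yE : setc y i (y i) = y.
  by apply/ffunP => j; rewrite setcE; case: eqP => [->|].
have wy : tilted s y = tilted s (setc y i (y i)) by rewrite yE.
have wf : tilted s (flip i y) = tilted s (setc y i (~~ y i)) by [].
rewrite /cmean wy wf /spin /tanhR; case: (y i) => /=; move: w0 e0; rewrite r;
  move: (tilted s (setc y i false)) (expR _) => a e a0 e0;
  by rewrite /sgnb; field; rewrite !gt_eqF ?addr_gt0 ?mulr_gt0.
Qed.

Lemma grad_cmean_le s i y z : (cmean (tilted s) i y - cmean (tilted s) i z) ^+ 2 <=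
  4 * ((grad i y - grad i z) * (cmean (tilted s) i y - cmean (tilted s) i z)).
Proof.
rewrite !cmean_tilted; apply: (le_trans (tanhR_sq_le _ _)).
by rewrite opprD addrACA subrr addr0.
Qed.

Lemma grad_cmean_ge0 s i y z :
  0 <= (grad i y - grad i z) * (cmean (tilted s) i y - cmean (tilted s) i z).
Proof.
have := le_trans (sqr_ge0 _) (grad_cmean_le s i y z).
by rewrite pmulr_rge0.
Qed.

(** A discrete derivative in direction [i] does not depend on coordinate [i], so the spin may be
    replaced by its conditional mean. *)
Lemma Cov_grad_spin s i :
  Cov (tilted s) (grad i) (spin i) = Cov (tilted s) (grad i) (cmean (tilted s) i).
Proof.
rewrite /Cov (meanv_cmean (tilted_gt0 s)) (Ex_spin (tilted_gt0 s))//.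
exact: grad_flip.
Qed.

Definition covsum s : R := \sum_i Cov (tilted s) (grad i) (spin i).

Lemma covsum_bound s :
  \sum_i Cov (tilted s) (cmean (tilted s) i) (cmean (tilted s) i) <= 4 * covsum s.
Proof.
rewrite mulr_sumr; apply: ler_sum => i _; rewrite Cov_grad_spin.
apply: Var_le_Cov; [exact: tilted_ge0|exact: tilted_sum|exact: grad_cmean_le].
Qed.

Lemma qLip_covsum : qLip n covsum.
Proof. by apply: qLip_sum => i; exact/bLip_qLip/Cov_tilted_bLip. Qed.

(* if the covariances vanish at one tilt, then all grad i are constant *)
Lemma covsum_le0 s : covsum s <= 0 -> forall s',
  \sum_i Cov (tilted s') (cmean (tilted s') i) (cmean (tilted s') i) <= 0.
Proof.
move=> c0 s'; rewrite big1// => i _.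
have Cge j : 0 <= Cov (tilted s) (grad j) (spin j).
  rewrite Cov_grad_spin; apply: Cov_ge0; [exact: tilted_ge0|exact: tilted_sum|].
  exact: grad_cmean_ge0.
have Ci : Cov (tilted s) (grad i) (cmean (tilted s) i) <= 0.
  rewrite -Cov_grad_spin; apply: le_trans c0.
  by rewrite /covsum (bigD1 i)//= lerDl sumr_ge0.
have gz := Cov_le0_eq (tilted_ge0 s) (tilted_sum s) (tilted_gt0 s)
  (grad_cmean_ge0 s i) Ci.
have gc y z : grad i y = grad i z.
  have := grad_cmean_le s i y z; rewrite gz mulr0 => h.
  have : (cmean (tilted s) i y - cmean (tilted s) i z) ^+ 2 = 0.
    by apply/eqP; rewrite eq_le h sqr_ge0.
  move/eqP; rewrite sqrf_eq0 subr_eq0 !cmean_tilted => /eqP/tanhR_inj.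
  exact: addIr.
rewrite CovE; last exact: tilted_sum.
rewrite big1 ?mulr0// => y _; rewrite big1// => z _.
by rewrite !cmean_tilted (gc y z) subrr !mulr0.
Qed.

(** The seed 0 of the maximum is the contribution of the zero vector adjoined to the gradients. *)
Definition maxgrad s : R :=
  \big[Num.max/0]_(y <- enum [set: cube n]%classic) \sum_(i < n) grad i y * nth 0 s i.

Lemma gcompl_maxgrad : gcompl_meas nu = gint n (fun s => (maxgrad s)%:E).
Proof.
rewrite /gcompl_meas /gcompl /gwidth; congr gint; apply/funext => s.
rewrite big_cons big_map /maxgrad.
have -> : \sum_(i < n) 0 * nth 0 s i = 0 :> R by rewrite big1// => i _; rewrite mul0r.
elim: (enum _) => [|y r IH]; first by rewrite !big_nil maxeNy.
by rewrite !big_cons maxCA IH EFin_max.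
Qed.

Lemma qLip_maxgrad : qLip n maxgrad.
Proof.
pose B := \sum_i \sum_y `|grad i y|.
have gB i y : `|grad i y| <= B.
  rewrite /B (bigD1 i)//= (bigD1 y)//= -addrA lerDl addr_ge0// ?sumr_ge0//.
  by move=> j _; rewrite sumr_ge0.
have B0 : 0 <= B by rewrite sumr_ge0// => i _; rewrite sumr_ge0.
apply: (@qLip_Lipschitz R n _ B) => s s'; rewrite /maxgrad.
have e0 : 0 <= B * dist1 n s s' by rewrite mulr_ge0 ?dist1_ge0.
elim: (enum _) => [|y r IH]; first by rewrite !big_nil subrr normr0.
rewrite !big_cons.
have lin : `|\sum_(i < n) grad i y * nth 0 s i - \sum_(i < n) grad i y * nth 0 s' i| <=
    B * dist1 n s s'.
  rewrite -sumrB mulr_sumr; apply: (le_trans (ler_norm_sum _ _ _)).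
  by apply: ler_sum => i _; rewrite -mulrBr normrM ler_wpM2r.
move: lin IH; move: (\sum_(i < n) _) (\sum_(i < n) _) => a a'.
move: (\big[_/_]_(_ <- _) _) (\big[_/_]_(_ <- _) _) => b b'.
rewrite !ler_norml => /andP[h1 h2] /andP[h3 h4].
by rewrite /Num.max; case: (ltP a b); case: (ltP a' b'); move=> h5 h6; apply/andP; split; lra.
Qed.

Lemma gcompl_EFin : gcompl_meas nu = (gEn n maxgrad)%:E.
Proof. by rewrite gcompl_maxgrad EFin_gEn//; exact: qLip_maxgrad. Qed.

Lemma gcompl_ge0 : 0 <= fine (gcompl_meas nu).
Proof.
rewrite gcompl_EFin /= -(gEn_cst n 0); apply: gEn_le.
- exact: qLip_cst.
- exact: qLip_maxgrad.
- by move=> s; exact: bigmax_ge_id.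
Qed.

Lemma gEn_covsum_le : delta * gEn n covsum <= fine (gcompl_meas nu).
Proof.
rewrite gcompl_EFin /= gEn_sum; last first.
  by move=> i; exact/bLip_qLip/Cov_tilted_bLip.
have nE i : qLip n (fun s => nth 0 s i * Ex (tilted s) (grad i)).
  by apply: qLip_coordM => //; exact: Ex_tilted_bLip.
rewrite mulr_sumr; under eq_bigr do rewrite -gEn_spin_ibp.
rewrite -gEn_sum//; apply: gEn_le; [exact: qLip_sum|exact: qLip_maxgrad|] => s.
have -> : \sum_(i < n) nth 0 s i * Ex (tilted s) (grad i) =
    Ex (tilted s) (fun y => \sum_i grad i y * nth 0 s i).
  rewrite Ex_sum; apply: eq_bigr => i _; rewrite -ExZ; apply: eq_bigr => y _.
  by rewrite (mulrC (nth _ _ _)).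
rewrite -[leRHS](Ex_cst (tilted_sum s)); apply: Ex_le => [|y]; first exact: tilted_ge0.
by apply: le_bigmax_seq => //; rewrite mem_enum in_setT.
Qed.

Lemma exists_tilt : exists2 s, norm1 n s <= 4 * n%:R &
  delta * \sum_i Cov (tilted s) (cmean (tilted s) i) (cmean (tilted s) i)
    <= 16 * fine (gcompl_meas nu).
Proof.
set D := fine _.
have D0 : 0 <= D by exact: gcompl_ge0.
(* If [covsum] is nonpositive at one point, all the variances vanish at every tilt, and the empty
   list, read as the zero vector, will do. Otherwise [covsum] is positive everywhere, which forces D
   > 0. *)
have [[s cs]|nc] := pselect (exists s, covsum s <= 0).
  exists [::].
    rewrite /norm1 big1 ?mulr_ge0// => i _; by rewrite nth_nil normr0.
  apply: (@le_trans _ _ 0); last by rewrite mulr_ge0.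
  by rewrite pmulr_rle0//; exact: covsum_le0 cs _.
have cpos s : 0 < covsum s by rewrite ltNge; apply/negP => h; apply: nc; exists s.
have n0 : 0 < n%:R :> R.
  rewrite ltr0n lt0n; apply/negP => /eqP n0; have := cpos [::].
  by rewrite /covsum big1 ?ltxx// => i _; have := ltn_ord i; rewrite {2}n0.
have Dpos : 0 < D.
  apply: lt_le_trans gEn_covsum_le; rewrite mulr_gt0//.
  by apply: gEn_gt0 => //; exact: qLip_covsum.
(* The mean of [G] is at most nD + 3nD. Where [G s <= 4nD], each of its two nonnegative terms obeys
   this bound, giving [delta * covsum s <= 4D] and [norm1 n s <= 4n]. *)
pose G s := n%:R * (delta * covsum s) + D * norm1 n s.
have nG1 : qLip n (fun s => n%:R * (delta * covsum s)).
  by do 2! apply: qLipZ; exact: qLip_covsum.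
have nG2 : qLip n (fun s => D * norm1 n s) by apply: qLipZ; exact: qLip_norm1.
have [||s Gs] := @gEn_le_exists R n G (n%:R * D * 4); first exact: qLipD.
  rewrite gEnD// gEnZ; last by apply: qLipZ; exact: qLip_covsum.
  rewrite !gEnZ; [|exact: qLip_norm1|exact: qLip_covsum].
  have h1 : n%:R * (delta * gEn n covsum) <= n%:R * D by rewrite ler_pM2l// gEn_covsum_le.
  have h2 : D * gEn n (norm1 n) <= D * (3 * n%:R) by rewrite ler_pM2l// gEn_norm1_le.
  by lra.
have c1 : 0 <= n%:R * (delta * covsum s) by rewrite !mulr_ge0 ?ltW.
have c2 : 0 <= D * norm1 n s by rewrite mulr_ge0 ?norm1_ge0.
exists s.
  rewrite -(ler_pM2l Dpos); rewrite /G in Gs; lra.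
have h : delta * covsum s <= 4 * D by rewrite -(ler_pM2l n0); rewrite /G in Gs; lra.
have := covsum_bound s; rewrite -(ler_pM2l delta_gt0) => h'.
by apply: (le_trans h'); lra.
Qed.

(** The difference is [ln Z - potential s y]. As [Z] is a [nu]-average of exponentials of the
    potential, [ln Z] obeys the same bound as the potential, whence the factor 2. *)
Lemma logdens_tilted s y :
  `|logdens nu y - logdens (tilted s) y| <= 2 * delta * norm1 n s.
Proof.
have m0 : 0 < mu_unif R y by rewrite invr_gt0 exprn_gt0.
set a := delta * norm1 n s.
have fa z : `|potential s z| <= a.
  rewrite /potential normrM gtr0_norm// ler_pM2l//.
  apply: (le_trans (ler_norm_sum _ _ _)); apply: ler_sum => j _.
  by rewrite normrM norm_spin mulr1.
pose Z := \sum_z nu z * expR (potential s z).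
have Z0 : 0 < Z by exact: partition_gt0.
have -> : logdens nu y - logdens (tilted s) y = ln Z - potential s y.
  rewrite /logdens /tilted /tilt -/Z.
  rewrite !ln_div ?posrE ?divr_gt0 ?mulr_gt0 ?expR_gt0//.
  rewrite lnM ?posrE ?expR_gt0// expRK; ring.
have Za : `|ln Z| <= a.
  rewrite ler_norml -[- a]expRK -[X in _ && (_ <= X)]expRK !ler_ln ?posrE ?expR_gt0//.
  have fa' z : - a <= potential s z <= a by rewrite -ler_norml.
  apply/andP; split.
    rewrite -[leLHS](Ex_cst nu1); apply: Ex_le => // z.
    by rewrite ler_expR; have /andP[] := fa' z.
  rewrite -[leRHS](Ex_cst nu1); apply: Ex_le => // z.
  by rewrite ler_expR; have /andP[] := fa' z.
by apply: (le_trans (ler_normB _ _)); have := fa y; rewrite -mulrA -/a; lra.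
Qed.

End ExponentialTilt.

(** * Choice of the tilt strength and assembly of the bounds *)

Theorem theorem1p1 (R : realType) (n : nat) (nu : cube n -> R) :
  is_prob nu -> (forall y, 0 < nu y) ->
  forall eps : R, 0 < eps -> eps < 1 / 16 ->
  exists nut : cube n -> R,
    [/\ is_prob nut, (forall y, 0 < nut y),
        (forall y, `|logdens nu y - logdens nut y| <= eps * n%:R) &
        forall xi : cube n -> R,
          is_prob xi -> is_product xi -> meanv xi = meanv nut ->
          W1 nut xi <= 2 ^+ 7 * Num.sqrt (n%:R * fine (gcompl_meas nu) / eps)
                       + 4 * n%:R * expR (- 1 / (64 * eps ^+ 2))
          /\ exists I : {set 'I_n},
               n%:R - 2 * n%:R * expR (- 1 / (32 * eps ^+ 2)) <= #|I|%:R /\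
               W1 nut (fun y => margJ xi I y * margJ nut (~: I) y)
                 <= 2 ^+ 6 * Num.sqrt (n%:R * fine (gcompl_meas nu) / eps)].
Proof.
move=> nup nu0 eps e0 e1; set D := fine _.
have D0 : 0 <= D by exact: gcompl_ge0.
(* The strength [eps / 8] makes the log-density error 2 (eps/8) 4n equal to eps n. *)
have d0 : 0 < eps / 8 by rewrite divr_gt0.
have d1 : eps / 8 <= 1 / 2 by lra.
have [s s1 s2] := exists_tilt nup nu0 d0 d1.
exists (tilted nu (eps / 8) s); split.
- exact: tilted_prob.
- by move=> y; exact: tilted_gt0.
- move=> y; apply: (le_trans (logdens_tilted nup nu0 d0 _ _)).
  have : eps * norm1 n s <= eps * (4 * n%:R) by rewrite ler_pM2l.
  by lra.
move=> xi xp xprod xm.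
have main : W1 (tilted nu (eps / 8) s) xi <= 2 ^+ 6 * Num.sqrt (n%:R * D / eps).
  apply: (le_trans (W1_product_le (tilted_prob nup nu0 _ s) (tilted_gt0 nup nu0 _ s) xp xprod xm)).
  set V := \sum_i _ in s2 *.
  have Vle : V <= 2 ^+ 7 * (D / eps).
    have -> : V = (eps / 8 * V) * (8 / eps) by field; rewrite gt_eqF.
    have -> : 2 ^+ 7 * (D / eps) = (16 * D) * (8 / eps) by field; rewrite gt_eqF.
    by rewrite ler_pM2r// divr_gt0.
  (* The bound in hand is half the square root of 2^7 nD/eps; the target is brought to the same
     shape, where 2^14 leaves ample room. *)
  have -> : 2 ^+ 6 * Num.sqrt (n%:R * D / eps) =
      Num.sqrt (2 ^+ 14 * (n%:R * D / eps)) / 2.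
    have -> : 2 ^+ 14 = (2 ^+ 7) ^+ 2 :> R by rewrite -exprM.
    by rewrite [in RHS]sqrtrM ?sqr_ge0// sqrtr_sqr ger0_norm ?exprn_ge0//; field.
  rewrite ler_pM2r// ler_wsqrtr//.
  apply: (@le_trans _ _ (n%:R * (2 ^+ 7 * (D / eps)))); first by rewrite ler_wpM2l.
  have p : 0 <= n%:R * D / eps by rewrite !mulr_ge0// invr_ge0 ltW.
  by rewrite mulrCA mulrA -[n%:R * _]/(n%:R * _); lra.
have Q0 : 0 <= Num.sqrt (n%:R * D / eps) by exact: sqrtr_ge0.
split.
  apply: (le_trans main).
  have : 0 <= 4 * n%:R * expR (- 1 / (64 * eps ^+ 2)).
    by rewrite mulr_ge0 ?expR_ge0// mulr_ge0.
  by lra.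
exists [set: 'I_n]%SET; split.
  rewrite cardsT card_ord gerBl mulr_ge0 ?expR_ge0// mulr_ge0//.
(* The marginal on all coordinates is [xi] itself, and the marginal on the empty set is the total
   mass 1. *)
suff -> : (fun y => margJ xi [set: 'I_n]%SET y * margJ (tilted nu (eps / 8) s) (~: [set: 'I_n]%SET) y) = xi.
  exact: main.
apply/funext => y; rewrite /margJ.
rewrite (big_pred1 y); last first.
  move=> z /=; apply/forall_inP/eqP => [h|-> //].
  by apply/ffunP => j; apply/eqP/h; rewrite inE.
rewrite (eq_bigl predT); last first.
  by move=> z /=; apply/forall_inP => j; rewrite !inE.
by rewrite (tilted_sum nup) mulr1.
Qed.
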